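(* Let $k=\mathbb{C}$, let $q\in k$ with $q\ne0$, and let $W_{\mathrm{qp}}=k\{x,y\}/(xy-qyx)$. Write $H^n=H^n(W_{\mathrm{qp}},W_{\mathrm{qp}})$ for Hochschild cohomology. 1. If $q$ is a primitive $N$th root of unity, then the center $H^0$ of $W_{\mathrm{qp}}$ is generated (as a $k$-algebra) by $x^N$ and $y^N$; otherwise (if $q$ is not a root of unity) the center is reduced to $k$. 2. $H^1$ is a free module of rank 2 over the center, with generators the classes of $x\partial_x$ and $y\partial_y$, which remain well-defined (as derivations) in $W_{\mathrm{qp}}$; it is just the two-dimensional $k$-vector space spanned by these two classes if $q$ is not a root of unity. 3. $H^2$ is the sum of the $k$-subspace spanned by the class of a 2-cocycle $z_{\mathrm{qp}}$ of $W_{\mathrm{qp}}$ which is a lift of the cocycle $\partial_x\wedge\partial_y$ of $k[x,y]$, and the free module over the center generated by the class of $x\partial_x\wedge y\partial_y$.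
   Context: $k\{x,y\}$ is the noncommutative polynomial ring (free associative algebra) in two variables. The Hochschild cohomology $H^*$ of an algebra with coefficients in itself is a module over the center of the algebra. On $W_{\mathrm{qp}}$, $x\partial_x$ denotes the derivation with $x\mapsto x,\ y\mapsto0$ and $y\partial_y$ the derivation with $x\mapsto0,\ y\mapsto y$. On $k[x,y]$, $\partial_x,\partial_y$ are the usual partial derivatives. For derivations $D_1,D_2$ of an algebra, $(D_1\smile D_2)(a,b)=D_1(a)D_2(b)$ and $D_1\wedge D_2=\tfrac12(D_1\smile D_2-D_2\smile D_1)$; these are Hochschild 2-cocycles. Deformation of $k[x,y]$ to $W_{\mathrm{qp}}$: let $m$ be the multiplication of $k[x,y]$ and set $a*b=m[\exp(\hbar\, x\partial_x\otimes y\partial_y)(a\otimes b)]$, so that $x*y=e^{\hbar}\,y*x$. For $a,b\in k[x,y]$ the series converges for every complex value of $\hbar$, and specializing $\hbar$ to a complex number with $e^{\hbar}=q$ gives (up to isomorphism, sending $x$ to $x$ and $y$ to $y$) the algebra $W_{\mathrm{qp}}$. A lift of a Hochschild cocycle $z$ of $k[x,y]$ to the deformed algebra is a cocycle for the deformed multiplication of the form $z_{\hbar}=z+\hbar z_1+\hbar^2z_2+\cdots$ with $z_i$ cochains of $k[x,y]$. A lift to $W_{\mathrm{qp}}$ means the specialization of such a $z_{\hbar}$, whose values on any arguments from $k[x,y]$ are convergent series in $\hbar$, at a complex value of $\hbar$ with $e^{\hbar}=q$.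
   Formalization: The descriptions of H^1 and H^2 (parts 2 and 3) are stated for q ≠ 1 only, since at q = 1 the algebra is k[x,y], whose H^1 contains ∂_x and whose H^2 is all of k[x,y]·∂_x∧∂_y, so both claims fail there. *)

(* Defs.v *)
From HB Require Import structures.
From mathcomp Require Import all_boot all_order all_algebra.
From mathcomp Require Import generic_quotient ring_quotient complex.
From mathcomp Require Import all_classical all_reals all_analysis.
From mathcomp Require monalg mpoly.
(* The notations of monalg and mpoly clash with those of MathComp-Analysis. *)
Import -(notations) monalg mpoly.
Import numFieldNormedType.Exports.

Set Implicit Arguments.
Unset Strict Implicit.
Unset Printing Implicit Defensive.

Import Order.TTheory GRing.Theory Num.Theory.

Local Open Scope classical_set_scope.
Local Open Scope ring_scope.
Local Open Scope quotient_scope.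

Section Cochains.
Variables (k : fieldType) (A : lmodType k).

Definition upd n (a : {ffun 'I_n -> A}) (i : 'I_n) (u : A) : {ffun 'I_n -> A} :=
  [ffun j => if j == i then u else a j].

Definition multilinear n (f : {ffun 'I_n -> A} -> A) : Prop :=
  forall (i : 'I_n) (a : {ffun 'I_n -> A}) (c : k) (u v : A),
    f (upd a i (c *: u + v)) = c *: f (upd a i u) + f (upd a i v).

(* (a_0, ..., a_n) |-> (a_0, ..., mu a_i a_(i+1), ..., a_n) *)
Definition contract (mu : A -> A -> A) n (i : 'I_n) (a : {ffun 'I_n.+1 -> A}) :
    {ffun 'I_n -> A} :=
  [ffun j : 'I_n =>
    if (j < i)%N then a (widen_ord (leqnSn n) j)
    else if j == i then mu (a (widen_ord (leqnSn n) i)) (a (lift ord0 i))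
    else a (lift ord0 j)].

(* Hochschild coboundary; it is linear in mu, so that for a formal
   multiplication sum_i h^i mu_i and a formal cochain sum_j h^j f_j the
   coefficient of h^m in the coboundary is the sum over i + j = m of
   hochd mu_i f_j. *)
Definition hochd (mu : A -> A -> A) n (f : {ffun 'I_n -> A} -> A)
    (a : {ffun 'I_n.+1 -> A}) : A :=
  mu (a ord0) (f [ffun i => a (lift ord0 i)])
  + \sum_(i < n) (-1) ^+ i.+1 *: f (contract mu i a)
  + (-1) ^+ n.+1 *: mu (f [ffun i => a (widen_ord (leqnSn n) i)]) (a ord_max).

End Cochains.

Section Center.
Variables (k : fieldType) (A : algType k).

Definition central : {pred A} := fun c => `[< forall a, c * a = a * c >].

Lemma centralP c : reflect (forall a, c * a = a * c) (c \in central).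
Proof. exact: asboolP. Qed.

Lemma central_subalg : subalg_closed central.
Proof.
split; first by apply/centralP => a; rewrite mul1r mulr1.
- move=> s u v /centralP hu /centralP hv; apply/centralP => a.
  by rewrite mulrDl mulrDr hv -scalerAl -scalerAr hu.
- move=> u v /centralP hu /centralP hv; apply/centralP => a.
  by rewrite -mulrA hv mulrA hu mulrA.
Qed.

HB.instance Definition _ := GRing.isSubalgClosed.Build k A central central_subalg.

Definition alg_center : Type := {c : A | c \in central}.
HB.instance Definition _ := [isSub of alg_center for @sval A (fun c => c \in central)].
HB.instance Definition _ := [Choice of alg_center by <:].
HB.instance Definition _ := [SubChoice_isSubAlgebra of alg_center by <:].

End Center.

Section Cohomology.
Variables (k : fieldType) (A : algType k).

Local Notation cochain n := ({ffun 'I_n -> A} -> A).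

Definition is_cocycle n (f : cochain n) : Prop :=
  multilinear f /\ hochd *%R f = 0.

Definition is_coboundary n : cochain n -> Prop :=
  match n with
  | 0 => fun f => f = 0
  | m.+1 => fun f => exists2 g : cochain m, multilinear g & f = hochd *%R g
  end.

Lemma multilinear0 n : multilinear (0 : cochain n).
Proof. by move=> i a c u v; rewrite /= scaler0 addr0. Qed.

Lemma multilinearB n (f g : cochain n) :
  multilinear f -> multilinear g -> multilinear (f - g).
Proof.
move=> hf hg i a c u v; rewrite !fctE /= hf hg scalerBr opprD addrACA //.
Qed.

Lemma hochd0 n : hochd *%R (0 : cochain n) = 0.
Proof.
apply/funext => a; rewrite /hochd /= mulr0 mul0r scaler0 addr0 add0r.
by rewrite big1 // => i _; rewrite scaler0.
Qed.

Lemma hochdB n (f g : cochain n) :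
  hochd *%R (f - g) = hochd *%R f - hochd *%R g.
Proof.
apply/funext => a; rewrite /hochd !fctE /= mulrBr mulrBl scalerBr.
under eq_bigr do rewrite scalerBr.
by rewrite sumrB !opprD [RHS]addrACA; congr (_ + _); rewrite [RHS]addrACA.
Qed.

Lemma hochdZ n (c : k) (f : cochain n) a :
  hochd *%R (fun b => c *: f b) a = c *: hochd *%R f a.
Proof.
rewrite /hochd !scalerDr -scalerAr scaler_sumr; congr (_ + _ + _).
  by apply: eq_bigr => i _; rewrite !scalerA mulrC.
by rewrite -scalerAl !scalerA mulrC.
Qed.

Definition cocycles n : {pred cochain n} := fun f => `[< is_cocycle f >].

Lemma cocycles_zmod n : zmod_closed (@cocycles n).
Proof.
split; first by apply/asboolP; split; [exact: multilinear0 | exact: hochd0].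
move=> f g /asboolP[mf df] /asboolP[mg dg]; apply/asboolP; split.
  exact: multilinearB.
by rewrite hochdB df dg subrr.
Qed.

HB.instance Definition _ n :=
  GRing.isZmodClosed.Build (cochain n) (@cocycles n) (cocycles_zmod n).

Definition cocycle n : Type := {f : cochain n | f \in @cocycles n}.
HB.instance Definition _ n :=
  [isSub of cocycle n for @sval (cochain n) (fun f => f \in @cocycles n)].
HB.instance Definition _ n := [Choice of cocycle n by <:].
HB.instance Definition _ n := [SubChoice_isSubZmodule of cocycle n by <:].

Definition mkCocycle n (f : cochain n) (hf : is_cocycle f) : cocycle n :=
  exist _ f (asboolT hf).

Definition coboundaries n : {pred cocycle n} :=
  fun z => `[< is_coboundary (val z) >].

Lemma val_cocycleB n (z w : cocycle n) : val (z - w) = val z - val w.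
Proof. exact: raddfB. Qed.

Lemma coboundaries_zmod n : zmod_closed (@coboundaries n).
Proof.
case: n => [|n]; split.
- by apply/asboolP.
- move=> f g /asboolP hf /asboolP hg; apply/asboolP; move: hf hg.
  by rewrite val_cocycleB /is_coboundary => -> ->; rewrite subrr.
- apply/asboolP => /=; exists 0; first exact: multilinear0.
  by rewrite hochd0.
- move=> f g /asboolP[f' mf hf] /asboolP[g' mg hg]; apply/asboolP.
  rewrite val_cocycleB hf hg; exists (f' - g'); first exact: multilinearB.
  by rewrite hochdB.
Qed.

HB.instance Definition _ n :=
  GRing.isZmodClosed.Build (cocycle n) (@coboundaries n) (coboundaries_zmod n).

(* Only z itself has to be a coboundary, so the definition does not rely on
   the square of the coboundary map being zero. *)
Definition HH n : Type := Quotient.quot (@coboundaries n).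
HB.instance Definition _ n := GRing.Zmodule.on (HH n).

Definition coh_class n (z : cocycle n) : HH n := \pi z.

Section Scale.
Variable c : alg_center A.

Definition ccochain n (f : cochain n) : cochain n := fun a => val c * f a.

Lemma ccochain_multilinear n (f : cochain n) : multilinear f -> multilinear (ccochain f).
Proof.
by move=> hf i a d u v; rewrite /ccochain hf mulrDr scalerAr.
Qed.

Lemma hochd_ccochain n (f : cochain n) :
  hochd *%R (ccochain f) = (fun a => val c * hochd *%R f a).
Proof.
apply/funext => a; rewrite /hochd /ccochain !mulrDr; congr (_ + _ + _).
- by rewrite mulrA -(centralP _ (valP c)) mulrA.
- by rewrite mulr_sumr; apply: eq_bigr => i _; rewrite scalerAr.
- by rewrite -mulrA scalerAr.
Qed.

Lemma ccocycle_proof n (z : cocycle n) : is_cocycle (ccochain (val z)).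
Proof.
case: z => f /= /asboolP[mf df]; split; first exact: ccochain_multilinear.
by rewrite hochd_ccochain df; apply/funext => a /=; rewrite mulr0.
Qed.

Definition ccocycle n (z : cocycle n) : cocycle n := mkCocycle (ccocycle_proof z).

Lemma ccocycleB n (z w : cocycle n) :
  ccocycle (z - w) = ccocycle z - ccocycle w.
Proof. by apply: val_inj; apply/funext => a; rewrite /= /ccochain mulrBr. Qed.

Lemma ccocycle_coboundary n (z : cocycle n) :
  z \in @coboundaries n -> ccocycle z \in @coboundaries n.
Proof.
move=> /asboolP hz; apply/asboolP => /=; case: n z hz => [|n] z /=.
  by move=> ->; apply/funext => a; exact: mulr0.
case=> g mg ->; exists (ccochain g); first exact: ccochain_multilinear.
by rewrite hochd_ccochain.
Qed.

Definition hh_scale n (h : HH n) : HH n := coh_class (ccocycle (repr h)).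

Lemma hh_scaleE n (z : cocycle n) : hh_scale (coh_class z) = coh_class (ccocycle z).
Proof.
apply/eqP; rewrite /hh_scale /coh_class -Quotient.idealrBE -ccocycleB.
by apply: ccocycle_coboundary; rewrite Quotient.idealrBE reprK.
Qed.

End Scale.

Lemma hh_scaleA n (c d : alg_center A) (h : HH n) :
  hh_scale c (hh_scale d h) = hh_scale (c * d) h.
Proof.
rewrite -[h]reprK -!/(coh_class _) !hh_scaleE; congr coh_class.
by apply: val_inj; apply/funext => a; rewrite /= /ccochain mulrA.
Qed.

Lemma hh_scale1 n : left_id 1 (@hh_scale ^~ n).
Proof.
move=> h; rewrite -[h]reprK -!/(coh_class _) !hh_scaleE; congr coh_class.
by apply: val_inj; apply/funext => a; rewrite /= /ccochain mul1r.
Qed.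

Lemma coh_classD n : {morph @coh_class n : z w / z + w}.
Proof. by move=> z w; rewrite /coh_class raddfD. Qed.

Lemma hh_scaleDr n : right_distributive (@hh_scale ^~ n) +%R.
Proof.
move=> c h1 h2; rewrite -[h1]reprK -[h2]reprK -!/(coh_class _).
rewrite -coh_classD !hh_scaleE -coh_classD; congr coh_class.
by apply: val_inj; apply/funext => a; rewrite /= /ccochain mulrDr.
Qed.

Lemma hh_scaleDl n (h : HH n) : {morph (@hh_scale ^~ n) ^~ h : c d / c + d}.
Proof.
move=> c d; rewrite -[h]reprK -!/(coh_class _) !hh_scaleE -coh_classD.
congr coh_class.
by apply: val_inj; apply/funext => a; rewrite /= /ccochain mulrDl.
Qed.

HB.instance Definition _ n := GRing.Zmodule_isLmodule.Build (alg_center A) (HH n)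
  (@hh_scaleA n) (@hh_scale1 n) (@hh_scaleDr n) (@hh_scaleDl n).

End Cohomology.

(* A 0-cochain is its value at the empty family, and HH 0 is the centre. *)
Lemma is_cocycle0P (k : fieldType) (A : algType k) (f : {ffun 'I_0 -> A} -> A) :
  is_cocycle f <-> (f [ffun i => 0] \in @central k A).
Proof.
have E b b' : f b = f b' by congr f; apply/ffunP; case.
split=> [[_ df]|/centralP hf].
  apply/centralP => a; have := congr1 (@^~ [ffun _ : 'I_1 => a]) df.
  rewrite /hochd big_ord0 addr0 !ffunE expr1 scaleN1r => /eqP.
  rewrite subr_eq0 => /eqP h.
  exact: etrans (congr1 ( *%R^~ a) (E _ _)) (etrans (esym h) (congr1 ( *%R a) (E _ _))).
split; first by case.
apply/funext => a; rewrite /hochd big_ord0 addr0 expr1 scaleN1r.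
rewrite (_ : ord0 = ord_max); last exact: val_inj.
apply/eqP; rewrite subr_eq0; apply/eqP.
exact: etrans (congr1 ( *%R _) (E _ _)) (etrans (esym (hf _)) (congr1 ( *%R^~ _) (E _ _))).
Qed.

Section Derivations.
Variables (k : fieldType) (A : algType k).

Record derivation := Derivation {
  der_fun :> {linear A -> A};
  derM : forall a b, der_fun (a * b) = der_fun a * b + a * der_fun b }.

Definition der_cochain (D : derivation) (a : {ffun 'I_1 -> A}) : A := D (a ord0).

Definition cup_cochain (D1 D2 : derivation) (a : {ffun 'I_2 -> A}) : A :=
  D1 (a ord0) * D2 (a ord_max).

Definition wedge_cochain (D1 D2 : derivation) (a : {ffun 'I_2 -> A}) : A :=
  2^-1 *: (cup_cochain D1 D2 a - cup_cochain D2 D1 a).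

Lemma der_cocycle_proof D : is_cocycle (der_cochain D).
Proof.
split.
  by move=> i a c u v; rewrite (ord1 i) /der_cochain !ffunE eqxx linearP.
apply/funext => a; rewrite /hochd /der_cochain big_ord1 !ffunE /=.
rewrite expr1 scaleN1r expr2 mulN1r opprK scale1r derM.
have -> : widen_ord (leqnSn 1) ord0 = ord0 by apply: val_inj.
have -> : lift ord0 ord0 = ord_max :> 'I_2 by apply: val_inj.
by rewrite opprD addrCA subrr addr0 addNr.
Qed.

Lemma cup_multilinear D1 D2 : multilinear (cup_cochain D1 D2).
Proof.
move=> i a c u v; rewrite /cup_cochain !ffunE.
case: (ord0 =P i) => [<-|/eqP ni].
  by rewrite /= linearP mulrDl scalerAl.
have -> : ord_max == i.
  by case: i ni => [[|[|i]]] //= hi _; apply/eqP/val_inj.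
by rewrite linearP mulrDr scalerAr.
Qed.

Lemma cup_hochd D1 D2 : hochd *%R (cup_cochain D1 D2) = 0.
Proof.
apply/funext => a; rewrite /hochd /cup_cochain 2!big_ord_recl big_ord0 !ffunE /=.
have -> : widen_ord (leqnSn 2) ord0 = ord0 by apply: val_inj.
have -> : widen_ord (leqnSn 2) (lift ord0 ord0) = lift ord0 ord0 by apply: val_inj.
have -> : widen_ord (leqnSn 2) ord_max = lift ord0 ord0 by apply: val_inj.
have -> : lift ord0 ord_max = ord_max :> 'I_3 by apply: val_inj.
have -> : lift ord0 (lift ord0 ord0) = ord_max :> 'I_3 by apply: val_inj.
have -> : (-1) ^+ (bump 0 0).+1 = 1 :> k by rewrite -signr_odd.
have -> : (-1) ^+ 3 = -1 :> k by rewrite -signr_odd.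
rewrite expr1 !scaleN1r scale1r addr0 !derM mulrDl mulrDr opprD !mulrA.
have E (x y z : A) : x + (- y - x + (z + y)) - z = 0.
  by rewrite (addrC z) addrACA addNr add0r addNKr subrr.
exact: E.
Qed.

Lemma wedge_cocycle_proof D1 D2 : is_cocycle (wedge_cochain D1 D2).
Proof.
split.
  move=> i a c u v; rewrite /wedge_cochain !cup_multilinear opprD addrACA.
  by rewrite -scalerBr scalerDr !scalerA mulrC.
apply/funext => a.
have -> : wedge_cochain D1 D2 =
    fun b => 2^-1 *: (cup_cochain D1 D2 - cup_cochain D2 D1) b by [].
by rewrite hochdZ hochdB !cup_hochd subrr scaler0.
Qed.

Definition der_cocycle D : cocycle A 1 := mkCocycle (der_cocycle_proof D).
Definition wedge D1 D2 : cocycle A 2 := mkCocycle (wedge_cocycle_proof D1 D2).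

End Derivations.

Definition subalgebra (k : fieldType) (A : algType k) (S : set A) : Prop :=
  [/\ S 1, forall (c : k) u v, S u -> S v -> S (c *: u + v) &
      forall u v, S u -> S v -> S (u * v)].

Definition two_sided_ideal (A : nzRingType) (I : set A) : Prop :=
  [/\ I 0, forall u v, I u -> I v -> I (u - v) &
      forall a u b, I u -> I (a * u * b)].

Section FreeAlgebra.
Variable k : fieldType.

(* k{x,y}, as the algebra of the free monoid on two letters. *)
Definition free2 : Type := malg (fmonom 'I_2) k.
HB.instance Definition _ := GRing.Lalgebra.on free2.

Lemma free2_scalerAr (c : k) (u v : free2) : c *: (u * v) = u * (c *: v).
Proof.
apply/malgP => m; rewrite monalg.mcoeffZ.
rewrite (mcoeffMlw m (finmap.fsubset_refl _) (finmap.fsubset_refl _)).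
rewrite (mcoeffMlw m (finmap.fsubset_refl _) (monalg.msuppZ_le c v)).
rewrite mulr_sumr; apply: eq_bigr => i _; rewrite mulr_sumr; apply: eq_bigr => j _.
by rewrite monalg.mcoeffZ mulrnAr mulrCA.
Qed.

HB.instance Definition _ :=
  GRing.LSemiAlgebra_isSemiAlgebra.Build k free2 free2_scalerAr.

Definition free_x : free2 := mkmalgU (fmu (ord0 : 'I_2)) 1.
Definition free_y : free2 := mkmalgU (fmu (ord_max : 'I_2)) 1.

End FreeAlgebra.

Section QuantumPlane.
Variables (k : fieldType) (q : k).

Definition qp_relation : free2 k :=
  free_x k * free_y k - q *: (free_y k * free_x k).

Definition qp_ideal : {pred free2 k} :=
  fun u => `[< smallest (@two_sided_ideal (free2 k)) [set qp_relation] u >].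

Lemma qp_idealM a u b : u \in qp_ideal -> a * u * b \in qp_ideal.
Proof.
move=> /asboolP hu; apply/asboolP => I [hI sI].
by case: (hI) => _ _; apply; apply: hu.
Qed.

Lemma qp_ideal_zmod : zmod_closed qp_ideal.
Proof.
split; first by apply/asboolP => I [[]].
move=> u v /asboolP hu /asboolP hv; apply/asboolP => I [hI sI].
by case: (hI) => _ + _; apply; [apply: hu | apply: hv].
Qed.

HB.instance Definition _ := GRing.isZmodClosed.Build (free2 k) qp_ideal qp_ideal_zmod.

Lemma qp_ideal1 : 1 \notin qp_ideal.
Proof.
pose ev : {rmorphism free2 k -> k} := @monalg.mcoeff (fmonom 'I_2) k (@mone _).
have evZ c u : ev (c *: u) = c * ev u by exact: monalg.mcoeffZ.
have evx : ev (free_x k) = 0.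
  rewrite /= monalg.mcoeffU (_ : _ == _ = false) //.
  by apply/eqP => /(congr1 (@fmonom_val _)); rewrite fmU fm1.
apply/negP => /asboolP /(_ [set u | ev u = 0]); rewrite /mkset rmorph1 => h.
suff /eqP : (1 : k) = 0 by rewrite oner_eq0.
apply: h; split; last by move=> _ ->; rewrite /= rmorphB evZ !rmorphM evx mul0r !mulr0 subr0.
split; first by rewrite /= rmorph0.
- move=> u v hu hv; change (ev (u - v) = 0).
  by rewrite rmorphB (hu : ev u = 0) (hv : ev v = 0) subr0.
- move=> a u b hu; change (ev (a * u * b) = 0).
  by rewrite !rmorphM (hu : ev u = 0) mulr0 mul0r.
Qed.

Definition Wqp : Type := Quotient.quot qp_ideal.
HB.instance Definition _ := GRing.Zmodule.on Wqp.

Definition qp_pi (u : free2 k) : Wqp := \pi u.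

Lemma qp_piK : cancel (@repr _ _ : Wqp -> free2 k) qp_pi.
Proof. exact: reprK. Qed.

Lemma qp_piP u v : reflect (qp_pi u = qp_pi v) (u - v \in qp_ideal).
Proof. by rewrite Quotient.idealrBE; apply: eqP. Qed.

Lemma qp_piD u v : qp_pi (u + v) = qp_pi u + qp_pi v.
Proof. by rewrite /qp_pi raddfD. Qed.

Definition qp_one : Wqp := qp_pi 1.
Definition qp_mul (a b : Wqp) : Wqp := qp_pi (repr a * repr b).
Definition qp_scale (c : k) (a : Wqp) : Wqp := qp_pi (c *: repr a).

Lemma qp_mulE u v : qp_mul (qp_pi u) (qp_pi v) = qp_pi (u * v).
Proof.
apply/qp_piP; set u' := repr _; set v' := repr _.
have hu : u' - u \in qp_ideal by apply/qp_piP; rewrite qp_piK.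
have hv : v' - v \in qp_ideal by apply/qp_piP; rewrite qp_piK.
rewrite (_ : _ - _ = 1 * (u' - u) * v' + u * (v' - v) * 1).
  by rewrite rpredD // qp_idealM.
by rewrite mul1r mulr1 mulrBl mulrBr addrA subrK.
Qed.

Lemma qp_scaleE c u : qp_scale c (qp_pi u) = qp_pi (c *: u).
Proof.
apply/qp_piP; set u' := repr _.
have hu : u' - u \in qp_ideal by apply/qp_piP; rewrite qp_piK.
rewrite (_ : _ - _ = (c *: 1) * (u' - u) * 1) ?qp_idealM //.
by rewrite mulr1 -scalerAl mul1r scalerBr.
Qed.

Lemma qp_mulA : associative qp_mul.
Proof.
by move=> a b c; rewrite -[a]qp_piK -[b]qp_piK -[c]qp_piK !qp_mulE mulrA.
Qed.

Lemma qp_mul1 : left_id qp_one qp_mul.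
Proof. by move=> a; rewrite -[a]qp_piK qp_mulE mul1r. Qed.

Lemma qp_mulr1 : right_id qp_one qp_mul.
Proof. by move=> a; rewrite -[a]qp_piK qp_mulE mulr1. Qed.

Lemma qp_mulDl : left_distributive qp_mul +%R.
Proof.
move=> a b c; rewrite -[a]qp_piK -[b]qp_piK -[c]qp_piK.
by rewrite -qp_piD !qp_mulE -qp_piD mulrDl.
Qed.

Lemma qp_mulDr : right_distributive qp_mul +%R.
Proof.
move=> a b c; rewrite -[a]qp_piK -[b]qp_piK -[c]qp_piK.
by rewrite -qp_piD !qp_mulE -qp_piD mulrDr.
Qed.

Lemma qp_one_neq0 : qp_one != 0.
Proof.
apply: contra qp_ideal1 => /eqP h; rewrite -[1]subr0; apply/qp_piP.
by rewrite -/qp_one h /qp_pi raddf0.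
Qed.

HB.instance Definition _ := GRing.Zmodule_isNzRing.Build Wqp
  qp_mulA qp_mul1 qp_mulr1 qp_mulDl qp_mulDr qp_one_neq0.

Lemma qp_scaleA c d a : qp_scale c (qp_scale d a) = qp_scale (c * d) a.
Proof. by rewrite -[a]qp_piK !qp_scaleE scalerA. Qed.

Lemma qp_scale1 : left_id 1 qp_scale.
Proof. by move=> a; rewrite -[a]qp_piK qp_scaleE scale1r. Qed.

Lemma qp_scaleDr : right_distributive qp_scale +%R.
Proof.
move=> c a b; rewrite -[a]qp_piK -[b]qp_piK -qp_piD !qp_scaleE -qp_piD.
by rewrite scalerDr.
Qed.

Lemma qp_scaleDl a : {morph qp_scale^~ a : c d / c + d}.
Proof. by move=> c d; rewrite -[a]qp_piK !qp_scaleE -qp_piD scalerDl. Qed.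

HB.instance Definition _ := GRing.Zmodule_isLmodule.Build k Wqp
  qp_scaleA qp_scale1 qp_scaleDr qp_scaleDl.

Lemma qp_scaleAl c (a b : Wqp) : c *: (a * b) = (c *: a) * b.
Proof.
rewrite -[a]qp_piK -[b]qp_piK; apply: etrans (congr1 (qp_scale c) (qp_mulE _ _)) _.
by apply: esym; apply: etrans (congr1 (qp_mul^~ _) (qp_scaleE _ _)) _;
  rewrite qp_mulE qp_scaleE scalerAl.
Qed.

HB.instance Definition _ := GRing.Lmodule_isLalgebra.Build k Wqp qp_scaleAl.

Lemma qp_scaleAr c (a b : Wqp) : c *: (a * b) = a * (c *: b).
Proof.
rewrite -[a]qp_piK -[b]qp_piK; apply: etrans (congr1 (qp_scale c) (qp_mulE _ _)) _.
by apply: esym; apply: etrans (congr1 (qp_mul _) (qp_scaleE _ _)) _;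
  rewrite qp_mulE qp_scaleE scalerAr.
Qed.

HB.instance Definition _ := GRing.LSemiAlgebra_isSemiAlgebra.Build k Wqp qp_scaleAr.

Definition qp_x : Wqp := qp_pi (free_x k).
Definition qp_y : Wqp := qp_pi (free_y k).

Lemma qp_xy : qp_x * qp_y = q *: (qp_y * qp_x).
Proof.
apply: etrans (qp_mulE _ _) _; apply: esym.
apply: etrans (congr1 (qp_scale q) (qp_mulE _ _)) _; rewrite qp_scaleE.
by apply/esym/qp_piP/asboolP => I [_]; apply.
Qed.

End QuantumPlane.

Section Deformation.
Variable R : realType.
Local Notation C := (R[i]%C).
Local Notation P := (mpoly 2 C).

Definition cexp (h : C) : C :=
  (expR (complex.Re h) * cos (complex.Im h)
   +i* (expR (complex.Re h) * sin (complex.Im h)))%C.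

(* C[x,y]: x is the variable of index ord0 and y the one of index ord_max. *)
Definition poly_var (i : 'I_2) : P := mpolyX C (mnm1 i).

Lemma mderivM_subproof (i : 'I_2) (p r : P) :
  mderiv i (p * r) = mderiv i p * r + p * mderiv i r.
Proof. exact: mderivM. Qed.

Definition partial (i : 'I_2) : derivation P :=
  @Derivation C P (mderiv i : {linear P -> P}) (mderivM_subproof i).

Definition euler (i : 'I_2) (p : P) : P := poly_var i * mderiv i p.

(* Coefficient of h^m in m[exp(h x d_x (x) y d_y)(p (x) r)]. *)
Definition star (m : nat) (p r : P) : P :=
  (m`!%:R)^-1 *: (iter m (euler ord0) p * iter m (euler ord_max) r).

(* Convergence in the finest locally convex topology of C[x,y]: the degrees
   stay bounded and every coefficient converges. *)
Definition mpoly_cvg (u : nat -> P) (p : P) : Prop :=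
  (exists d, forall n, (mmeasure mdeg (u n) <= d)%N) /\
  forall m, (fun n => mpoly.mcoeff m (u n) : C^o) @ \oo --> (mpoly.mcoeff m p : C^o).

(* sum_i h^i t_i = p *)
Definition psum (t : nat -> P) (h : C) (p : P) : Prop :=
  mpoly_cvg (series (fun i => h ^+ i *: t i)) p.

(* sum_j h^j (zh j) is a cocycle for the formal multiplication
   sum_i h^i (star i), with constant term z. *)
Definition formal_lift n (z : cocycle P n)
    (zh : nat -> {ffun 'I_n -> P} -> P) : Prop :=
  [/\ zh 0%N = val z, forall j, multilinear (zh j) &
      forall m a, \sum_(i < m.+1) hochd (star i) (zh (m - i)%N) a = 0].

(* phi identifies the specialization at h of the deformed algebra with Wqp q. *)
Definition specialization (q h : C) (phi : {linear P -> Wqp q}) : Prop :=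
  [/\ bijective phi, phi (poly_var ord0) = qp_x q, phi (poly_var ord_max) = qp_y q &
      forall p r, exists s, psum (fun i => star i p r) h s /\ phi s = phi p * phi r].

(* The values of the formal lift are entire in the deformation parameter; w is
   its specialization at a logarithm h of q, transported along phi. *)
Definition is_lift (q : C) n (z : cocycle P n) (w : cocycle (Wqp q) n) : Prop :=
  exists (h : C) (phi : {linear P -> Wqp q}) (zh : nat -> {ffun 'I_n -> P} -> P),
  [/\ cexp h = q, specialization h phi, formal_lift z zh,
      forall h' a, exists s, psum (zh ^~ a) h' s &
      forall a s, psum (zh ^~ a) h s -> val w [ffun i => phi (a i)] = phi s].

End Deformation.

(* Main.v *)
(* The monomials y^b x^a form a basis of Wqp: they span by the relation
   xy = qyx, and they are independent because Wqp acts on k[x,y] by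
   x . X^c Y^d = q^d X^(c+1) Y^d and y . X^c Y^d = X^c Y^(d+1).  Commutators with
   x and y are diagonal in this basis, which yields the centre, and a derivation
   D, being determined by (D x, D y), is compared coefficient by coefficient
   with inner derivations and central multiples of x d_x and y d_y.

   For a 2-cocycle f put K f = f(x,y) - q f(y,x).  If K f is of the form
   q (y u + v x) - (x v + u y), then (x,u) and (y,v) q-commute in the square-zero
   extension of Wqp by itself defined by f; sending y^b x^a to (y,v)^b (x,u)^a
   splits this extension, so f is a coboundary.  Solving for u and v in the
   monomial basis, the only obstructions are the coefficients of K f at 1 and at
   the monomials y^(b+1) x^(a+1) with q^a = q^b = 1.  A lift of d_x /\ d_y
   accounts for the first and x d_x /\ y d_y for the others.

   The lift is explicit: with E = e^h, replace the partial derivatives in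
   (1/2)(d_x (x) d_y - d_y (x) d_x) by difference quotients of ratio 1/E, with
   suitable powers of E as weights.  Its structure constants are Laurent
   polynomials in E, hence entire in h, and both the formal cocycle condition
   and the specialized one follow from the same identity, in which only
   E^n E^n' = E^(n+n') is used. *)
Require Import Defs.
From HB Require Import structures.
From mathcomp Require Import all_boot all_order all_algebra complex finmap.
From mathcomp Require Import all_classical all_reals all_analysis.
From mathcomp Require Import ring.
From mathcomp Require monalg mpoly.
Import -(notations) monalg mpoly.
Import numFieldNormedType.Exports.

Import Order.TTheory GRing.Theory Num.Theory.
Local Open Scope classical_set_scope.
Local Open Scope ring_scope.

Set Implicit Arguments.
Unset Strict Implicit.
Unset Printing Implicit Defensive.

(** * Linear extensions and the monomial basis *)

Lemma linear_0 (k : fieldType) (U V : lmodType k) (f : U -> V) : linear f -> f 0 = 0.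
Proof. by move=> lf; have := lf (-1) 0 0; rewrite !scaleN1r !addNr. Qed.

Section TwoVariables.
Variable k : fieldType.
Local Notation P := (mpoly 2 k).

Definition mn (a b : nat) : multinom 2 := Multinom [tuple of [:: a; b]].

Lemma mn_0 a b : mn a b ord0 = a. Proof. by []. Qed.
Lemma mn_1 a b : mn a b ord_max = b. Proof. by []. Qed.

Lemma ord2P (i : 'I_2) : i = ord0 \/ i = ord_max.
Proof. by case: i => [[|[|i]] hi] //; [left | right]; apply: val_inj. Qed.

Lemma mnE (m : multinom 2) : m = mn (m ord0) (m ord_max).
Proof. by apply/mnmP => i; case: (ord2P i) => ->. Qed.

Lemma mnD a b c d : mnm_add (mn a b) (mn c d) = mn (a + c) (b + d).
Proof. by apply/mnmP => i; rewrite mnmDE; case: (ord2P i) => ->. Qed.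

Lemma mn_inj a b c d : (mn a b == mn c d) = (a == c) && (b == d).
Proof.
apply/eqP/andP => [/mnmP h|[/eqP-> /eqP->]//].
by move: (h ord0) (h ord_max); rewrite !mn_0 !mn_1 => -> ->.
Qed.

Definition xymon (a b : nat) : P := mpolyX k (mn a b).
Local Notation mono := xymon.

Lemma monoM a b c d : mono a b * mono c d = mono (a + c) (b + d).
Proof. by rewrite /xymon -mpolyXD mnD. Qed.

Lemma mcoeff_mono a b c d : mpoly.mcoeff (mn a b) (mono c d) = ((c == a) && (d == b))%:R.
Proof. by rewrite /xymon mcoeffX mn_inj. Qed.

Lemma mono_ind (S : P -> Prop) :
  S 0 -> (forall c a b p, S p -> S (c *: mono a b + p)) -> forall p, S p.
Proof.
by move=> S0 Sr; elim/mpolyind => // c m p _ _ hp; rewrite (mnE m); apply: Sr.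
Qed.

Section LinearExtension.
Variables (V : lmodType k) (F : nat -> nat -> V).

Definition linext (p : P) : V :=
  \sum_(m <- mpoly.msupp p) mpoly.mcoeff m p *: F (m ord0) (m ord_max).

Lemma linextEw (r : seq (multinom 2)) (p : P) : uniq r ->
  {subset mpoly.msupp p <= r} ->
  linext p = \sum_(m <- r) mpoly.mcoeff m p *: F (m ord0) (m ord_max).
Proof.
move=> ur sr; rewrite /linext [RHS](bigID (fun m => m \in mpoly.msupp p)) /=.
rewrite [X in _ + X]big1 ?addr0 => [|m /memN_msupp_eq0->]; last by rewrite scale0r.
rewrite -[RHS]big_filter; apply: perm_big; apply: uniq_perm.
- exact: mpoly.msupp_uniq.
- exact: filter_uniq.
by move=> m; rewrite mem_filter; case: (boolP (m \in _)) => // /sr ->.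
Qed.

Lemma linext_is_linear : linear linext.
Proof.
move=> c u v; set r := undup (mpoly.msupp (c *: u + v) ++ mpoly.msupp u ++ mpoly.msupp v).
have ur : uniq r by exact: undup_uniq.
rewrite !(linextEw ur); do ?by move=> m hm; rewrite mem_undup !mem_cat hm ?orbT.
rewrite scaler_sumr -big_split /=.
by apply: eq_bigr => m _; rewrite mpoly.mcoeffD mpoly.mcoeffZ scalerDl scalerA.
Qed.

HB.instance Definition _ := GRing.isLinear.Build k P V _ linext linext_is_linear.

Lemma linext_mono a b : linext (mono a b) = F a b.
Proof. by rewrite /linext /xymon mpoly.msuppX big_seq1 mcoeffX eqxx scale1r. Qed.

End LinearExtension.

Lemma mono_ext (V : lmodType k) (f g : P -> V) : linear f -> linear g ->
  (forall a b, f (mono a b) = g (mono a b)) -> f =1 g.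
Proof.
move=> lf lg fg p.
elim/mono_ind: p => [|c a b p IH]; first by rewrite !linear_0.
by rewrite lf lg fg IH.
Qed.

End TwoVariables.

(** * Linear maps out of a monoid algebra *)

Section MonalgExtension.
Variables (k : fieldType) (K : monomType) (V : lmodType k) (F : K -> V).

Definition malg_ext (u : malg K k) : V :=
  \sum_(m <- monalg.msupp u) monalg.mcoeff m u *: F m.

Lemma malg_extEw (d : {fset K}%fset) (u : malg K k) :
  finmap.fsubset (monalg.msupp u) d ->
  malg_ext u = \sum_(m <- d) monalg.mcoeff m u *: F m.
Proof.
move=> le; rewrite /malg_ext (finmap.big_fset_incl _ le) //= => m _.
by rewrite -monalg.mcoeff_eq0 => /eqP ->; rewrite scale0r.
Qed.

Lemma malg_ext_is_linear : linear malg_ext.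
Proof.
move=> c u v; set d := finmap.fsetU (monalg.msupp (c *: u + v))
   (finmap.fsetU (monalg.msupp u) (monalg.msupp v)).
have h1 : finmap.fsubset (monalg.msupp (c *: u + v)) d by exact: finmap.fsubsetUl.
have h2 : finmap.fsubset (monalg.msupp u) d.
  by apply: finmap.fsubset_trans (finmap.fsubsetUr _ _); exact: finmap.fsubsetUl.
have h3 : finmap.fsubset (monalg.msupp v) d.
  by apply: finmap.fsubset_trans (finmap.fsubsetUr _ _); exact: finmap.fsubsetUr.
rewrite (malg_extEw h1) (malg_extEw h2) (malg_extEw h3) scaler_sumr -big_split /=.
by apply: eq_bigr => m _; rewrite monalg.mcoeffD monalg.mcoeffZ scalerDl scalerA.
Qed.

HB.instance Definition _ := GRing.isLinear.Build k (malg K k) V _ malg_ext malg_ext_is_linear.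

Lemma malg_extU m c : malg_ext (mkmalgU m c) = c *: F m.
Proof.
rewrite (malg_extEw (monalg.msuppU_le)) finmap.big_seq_fset1.
by rewrite monalg.mcoeffUU.
Qed.

End MonalgExtension.

Lemma malg_induct (k : fieldType) (K : monomType) (S : malg K k -> Prop) :
  S 0 -> (forall c m u, S u -> S (c *: mkmalgU m 1 + u)) -> forall u, S u.
Proof.
move=> S0 Sr u; rewrite [u]monalg.monalgE.
elim: (X in \sum_(_ <- X) _) => [|m r IH]; first by rewrite big_nil.
rewrite big_cons (_ : mkmalgU m _ = monalg.mcoeff m u *: mkmalgU m 1); first exact: Sr.
by apply/malgP => m'; rewrite monalg.mcoeffZ !monalg.mcoeffU mulrnAr mulr1.
Qed.

Lemma alg_mulDr (k : fieldType) (A : algType k) c (a u v : A) :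
  a * (c *: u + v) = c *: (a * u) + a * v.
Proof. by rewrite mulrDr -scalerAr. Qed.

Lemma alg_mulDl (k : fieldType) (A : algType k) c (a u v : A) :
  (c *: u + v) * a = c *: (u * a) + v * a.
Proof. by rewrite mulrDl -scalerAl. Qed.

Definition qmon (k : fieldType) (A : algType k) (x y : A) (a b : nat) : A :=
  y ^+ b * x ^+ a.

(** * Normal ordering of q-commuting elements *)

Section QuantumCommutation.
Variables (k : fieldType) (q : k) (A : algType k) (x y : A).
Hypothesis xy : x * y = q *: (y * x).

Lemma qcomm_xYn b : x * y ^+ b = q ^+ b *: (y ^+ b * x).
Proof.
elim: b => [|b IH]; first by rewrite mulr1 mul1r scale1r.
by rewrite [y ^+ _]exprS mulrA xy -scalerAl -[y * x * _]mulrA IH -scalerAr scalerA mulrA -!exprS.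
Qed.

Lemma qcomm_XnYn a b : x ^+ a * y ^+ b = q ^+ (a * b) *: (y ^+ b * x ^+ a).
Proof.
elim: a => [|a IH]; first by rewrite mul0n mulr1 mul1r scale1r.
rewrite [x ^+ a.+1]exprS -[x * x ^+ a * _]mulrA IH -scalerAr [x * (y ^+ b * _)]mulrA.
rewrite qcomm_xYn -scalerAl.
by rewrite scalerA -exprD addnC mulrA -mulSn.
Qed.

(** Moving [x ^+ a] across [y ^+ d] takes a * d swaps, each at the cost of a factor q. The algebra
    is arbitrary because the formula is needed again for lifts of x and y to an extension. *)
Lemma qcommM a b c d : (y ^+ b * x ^+ a) * (y ^+ d * x ^+ c) =
  q ^+ (a * d) *: (y ^+ (b + d) * x ^+ (a + c)).
Proof.
rewrite mulrA -[y ^+ b * _ * _]mulrA qcomm_XnYn -scalerAr -scalerAl mulrA.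
by rewrite -exprD -mulrA -exprD.
Qed.

End QuantumCommutation.

(** * Independence of the ordered monomials *)

Section Basis.
Variables (k : fieldType) (q : k).
Local Notation P := (mpoly 2 k).
Local Notation W := (Wqp q).
Local Notation mono := (@xymon k).
Local Notation x := (qp_x q).
Local Notation y := (qp_y q).

(** [opX] and [opY] act as left multiplication by x and y has to act on ordered monomials,
    [mono c d] standing for [y ^+ d * x ^+ c]. They are available before these monomials are known
    to be independent. *)
Definition opX : P -> P := linext (fun c d => q ^+ d *: mono c.+1 d).
Definition opY : P -> P := linext (fun c d => mono c d.+1).
HB.instance Definition _ := GRing.Linear.on opX.
HB.instance Definition _ := GRing.Linear.on opY.

Lemma opX_mono a b : opX (mono a b) = q ^+ b *: mono a.+1 b.
Proof. exact: linext_mono. Qed.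

Lemma opY_mono a b : opY (mono a b) = mono a b.+1.
Proof. exact: linext_mono. Qed.

Lemma opXY p : opX (opY p) = q *: opY (opX p).
Proof.
apply: (@mono_ext k P (fun p => opX (opY p)) (fun p => q *: opY (opX p))).
- by move=> c u v; rewrite !linearP.
- by move=> c u v; rewrite !linearP.
- move=> a b; rewrite opY_mono !opX_mono linearZ /= opY_mono scalerA.
  by rewrite -exprS.
Qed.

Definition letter (i : 'I_2) : free2 k := if i == ord0 then free_x k else free_y k.
Definition word (m : seq 'I_2) : free2 k := foldr (fun i u => letter i * u) 1 m.
Definition op (i : 'I_2) : P -> P := if i == ord0 then opX else opY.

Lemma wordE m : word m = mkmalgU (FMonom m) 1.
Proof.
elim: m => [|i m IH]; first by rewrite -fmoneE.
rewrite /= IH (_ : letter i = mkmalgU (fmu i) 1); last first.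
  by case: (ord2P i) => ->.
apply: etrans (monalg.fgmulUU _ _ _ _) _; rewrite mulr1.
by rewrite -[mmul _ _]/(fmmul (fmu i) (FMonom m)) fmmulE fmuE.
Qed.

Lemma free2_ind (S : free2 k -> Prop) :
  S 0 -> (forall c m u, S u -> S (c *: word m + u)) -> forall u, S u.
Proof.
move=> S0 Sr; apply: malg_induct => // c [m] u Su.
by rewrite -wordE; exact: Sr.
Qed.

(** The representation of the free algebra in which the letters act by [opX] and [opY]. The vector
    comes first so that [rho p] is a linear map on the free algebra. *)
Definition rho (p : P) (u : free2 k) : P :=
  malg_ext (fun m : fmonom 'I_2 => foldr op p (fmonom_val m)) u.

Lemma rho_linear p : linear (rho p).
Proof. exact: linearP. Qed.

HB.instance Definition _ p := GRing.isLinear.Build k (free2 k) P _ (rho p) (rho_linear p).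

Lemma rho_lin p c u v : rho p (c *: u + v) = c *: rho p u + rho p v.
Proof. exact: rho_linear. Qed.

Lemma rho_word p m : rho p (word m) = foldr op p m.
Proof. by rewrite wordE /rho malg_extU scale1r. Qed.

Lemma rho_letter p i u : rho p (letter i * u) = op i (rho p u).
Proof.
elim/free2_ind: u => [|c m u IH].
  by rewrite mulr0 linear0 /op; case: ifP => _; rewrite linear0.
rewrite alg_mulDr (rho_lin p c (letter i * word m)) (rho_lin p c (word m)).
rewrite [X in _ + X = _]IH.
rewrite -[letter i * word m]/(word (i :: m)) !rho_word /=.
by rewrite /op; case: ifP => _; rewrite linearP.
Qed.

Lemma rhoM p u v : rho p (u * v) = rho (rho p v) u.
Proof.
elim/free2_ind: u => [|c m u IH]; first by rewrite mul0r !linear0.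
rewrite (alg_mulDl c v (word m) u) (rho_lin p c (word m * v)) (rho_lin (rho p v) c (word m) u).
rewrite [X in _ + X = _]IH; apply: (congr1 (fun z => c *: z + _)).
rewrite rho_word; elim: m => [|i m IHm]; first by rewrite mul1r.
by rewrite -mulrA rho_letter IHm.
Qed.

Lemma rho_x p : rho p (free_x k) = opX p.
Proof.
rewrite -[free_x k]mulr1 (rho_letter p ord0).
by rewrite -[1]/(word [::]) rho_word.
Qed.

Lemma rho_y p : rho p (free_y k) = opY p.
Proof.
rewrite -[free_y k]mulr1 (rho_letter p ord_max).
by rewrite -[1]/(word [::]) rho_word.
Qed.

Lemma rho_xy p : rho p (free_x k * free_y k) = opX (opY p).
Proof. by rewrite rhoM rho_x rho_y. Qed.

Lemma rho_yx p : rho p (free_y k * free_x k) = opY (opX p).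
Proof. by rewrite rhoM rho_x rho_y. Qed.

Lemma rho_0 u : rho 0 u = 0.
Proof.
elim/free2_ind: u => [|c m u IH]; first by rewrite linear0.
rewrite rho_lin IH rho_word addr0 -[RHS](scaler0 _ c); congr (_ *: _).
by elim: m => //= i m ->; rewrite /op; case: ifP => _; rewrite linear0.
Qed.

Lemma rho_ideal p u v : u - v \in qp_ideal q -> rho p u = rho p v.
Proof.
(* The annihilator of the whole module is a two-sided ideal; that of a single vector would only be a
   left ideal. *)
move=> /asboolP /(_ [set w | forall p, rho p w = 0]) h.
apply/eqP; rewrite -subr_eq0 -linearB; apply/eqP; apply: h; split.
  split.
  - by move=> p'; rewrite linear0.
  - by move=> w w' hw hw' p'; rewrite linearB /= hw hw' subrr.
  - by move=> a w b hw p'; rewrite !rhoM hw rho_0.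
move=> _ -> p'; rewrite /qp_relation linearB linearZ /=.
apply: etrans (congr2 (fun u v => u - q *: v) (rho_xy p') (rho_yx p')) _.
by rewrite opXY subrr.
Qed.

Local Notation qmono := (qmon x y).

Definition qp_phi : P -> W := linext qmono.
HB.instance Definition _ := GRing.Linear.on qp_phi.

Lemma phi_mono a b : qp_phi (mono a b) = qmono a b.
Proof. exact: linext_mono. Qed.

Lemma phi_opX p : qp_phi (opX p) = x * qp_phi p.
Proof.
apply: (@mono_ext k W (fun p => qp_phi (opX p)) (fun p => x * qp_phi p)).
- by move=> c u v; rewrite !linearP.
- by move=> c u v; rewrite !linearP mulrDr scalerAr.
move=> a b; rewrite opX_mono linearZ /= !phi_mono /qmon.
have := qcommM (qp_xy q) 1 0 a b.
by rewrite expr1 expr0 mul1r mul1n add0n add1n => <-.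
Qed.

Lemma phi_opY p : qp_phi (opY p) = y * qp_phi p.
Proof.
apply: (@mono_ext k W (fun p => qp_phi (opY p)) (fun p => y * qp_phi p)).
- by move=> c u v; rewrite !linearP.
- by move=> c u v; rewrite !linearP mulrDr scalerAr.
move=> a b; rewrite opY_mono !phi_mono /qmon.
have := qcommM (qp_xy q) 0 1 a b.
by rewrite expr1 expr0 mulr1 mul0n expr0 scale1r add0n add1n => <-.
Qed.

Lemma qp_piM u v : qp_pi q (u * v) = qp_pi q u * qp_pi q v.
Proof. by rewrite -qp_mulE. Qed.

Lemma qp_piZ c u : qp_pi q (c *: u) = c *: qp_pi q u.
Proof. by rewrite -qp_scaleE. Qed.

Lemma qp_pi_linear : linear (qp_pi q).
Proof. by move=> c u v; rewrite qp_piD qp_piZ. Qed.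

(** [qp_phi] intertwines the representation with left multiplication in the quotient. At the
    constant polynomial 1 this recovers the class of u, whence the surjectivity of [qp_phi]. *)
Lemma phi_rho p u : qp_phi (rho p u) = qp_pi q u * qp_phi p.
Proof.
elim/free2_ind: u => [|c m u IH].
  rewrite [rho p 0]linear0 [LHS]linear0 (linear_0 qp_pi_linear); exact: esym (mul0r _).
apply: etrans (congr1 qp_phi (rho_lin p c (word m) u)) _.
apply: etrans (linearP _ _ _ _) _; rewrite /= IH.
apply: esym; apply: etrans (congr1 ( *%R^~ _) (qp_pi_linear c (word m) u)) _.
apply: etrans (alg_mulDl _ _ _ _) _; apply: (congr1 (fun z => c *: z + _)); apply: esym.
rewrite rho_word; elim: m => [|i m IHm] /=; first exact: esym (mul1r _).
apply: esym; apply: etrans (congr1 ( *%R^~ _) (qp_piM (letter i) (word m))) _.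
apply: etrans (esym (mulrA _ _ _)) _; rewrite -IHm /op /letter; case: ifP => _.
  exact: esym (phi_opX _).
exact: esym (phi_opY _).
Qed.

(** The result of letting w act on the constant polynomial 1; by [rho_ideal] it does not depend on
    the representative. *)
Definition qp_psi (w : W) : P := rho (mono 0 0) (repr w).

Lemma psiK : cancel qp_psi qp_phi.
Proof.
by move=> w; rewrite /qp_psi phi_rho phi_mono /qmon !expr0 !mulr1 qp_piK.
Qed.

Lemma psi_pi u : qp_psi (qp_pi q u) = rho (mono 0 0) u.
Proof. by apply: rho_ideal; apply/qp_piP; rewrite qp_piK. Qed.

Lemma psi_linear : linear qp_psi.
Proof.
move=> c u v; rewrite -[u]qp_piK -[v]qp_piK.
rewrite -(qp_pi_linear c (repr u) (repr v)) (psi_pi (repr u)) (psi_pi (repr v)).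
by rewrite (psi_pi (c *: repr u + repr v)) rho_lin.
Qed.

HB.instance Definition _ := GRing.isLinear.Build k W P _ qp_psi psi_linear.

Lemma qp_piX u n : qp_pi q (u ^+ n) = qp_pi q u ^+ n.
Proof. by elim: n => [|n IH] //; rewrite !exprS qp_piM IH. Qed.

Lemma rho_pow u (f : P -> P) n p : (forall p, rho p u = f p) ->
  rho p (u ^+ n) = iter n f p.
Proof.
move=> uf; elim: n => [|n IH]; first by rewrite expr0 -[1]/(word [::]) rho_word.
by rewrite exprS rhoM uf IH.
Qed.

(** No power of q appears, since the factors x act first, on monomials of degree 0 in the second
    variable. *)
Lemma psi_qmono a b : qp_psi (qmono a b) = mono a b.
Proof.
rewrite /qmon -!qp_piX -qp_piM psi_pi rhoM (rho_pow a (mono 0 0) rho_x) (rho_pow b _ rho_y).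
have -> : iter a opX (mono 0 0) = mono a 0.
  by elim: a => //= a ->; rewrite opX_mono expr0 scale1r.
by elim: b => //= b ->; rewrite opY_mono.
Qed.

Lemma phiK : cancel qp_phi qp_psi.
Proof.
apply: (@mono_ext k P (fun p => qp_psi (qp_phi p)) id).
- by move=> c u v; rewrite !linearP.
- by [].
by move=> a b; rewrite phi_mono psi_qmono.
Qed.

End Basis.

(** * Algebras with a basis of ordered monomials *)

Section PBW.
Variables (k : fieldType) (q : k) (A : algType k) (x y : A).
Local Notation P := (mpoly 2 k).
Local Notation mono := (@xymon k).

Local Notation M := (qmon x y).

(** Isolates what the cohomology computations use of the quantum plane, so that they take place in
    an abstract algebra and never unfold the quotient. *)
Record pbw_basis := PBWBasis {
  pbw_xy : x * y = q *: (y * x);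
  pbw_phi : {linear P -> A};
  pbw_psi : {linear A -> P};
  pbw_phiK : cancel pbw_phi pbw_psi;
  pbw_psiK : cancel pbw_psi pbw_phi;
  pbw_mono : forall a b, pbw_phi (mono a b) = M a b }.

Variable B : pbw_basis.
Local Notation phi := (pbw_phi B).
Local Notation psi := (pbw_psi B).
Local Notation phiK := (pbw_phiK B).
Local Notation psiK := (pbw_psiK B).
Local Notation phi_mono := (pbw_mono B).

Lemma MM a b c d : M a b * M c d = q ^+ (a * d) *: M (a + c) (b + d).
Proof. exact: qcommM (pbw_xy B) _ _ _ _. Qed.

Lemma M00 : M 0 0 = 1. Proof. by rewrite /qmon !expr0 mulr1. Qed.
Lemma M10 : M 1 0 = x. Proof. by rewrite /qmon expr0 mul1r. Qed.
Lemma M01 : M 0 1 = y. Proof. by rewrite /qmon expr0 mulr1. Qed.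

Lemma xM a b : x * M a b = q ^+ b *: M a.+1 b.
Proof. by rewrite -{1}M10 MM mul1n. Qed.
Lemma Mx a b : M a b * x = M a.+1 b.
Proof. by rewrite -{2}M10 MM muln0 scale1r addn1 addn0. Qed.
Lemma yM a b : y * M a b = M a b.+1.
Proof. by rewrite -{1}M01 MM mul0n scale1r. Qed.
Lemma My a b : M a b * y = q ^+ a *: M a b.+1.
Proof. by rewrite -{2}M01 MM muln1 addn0 addn1. Qed.

Lemma pbw_psiM a b : psi (M a b) = mono a b.
Proof. by rewrite -phi_mono phiK. Qed.

Lemma pbw_ext (V : lmodType k) (f g : A -> V) : linear f -> linear g ->
  (forall a b, f (M a b) = g (M a b)) -> f =1 g.
Proof.
move=> lf lg fg w; rewrite -[w]psiK.
apply: (@mono_ext k V (fun p => f (phi p)) (fun p => g (phi p))).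
- by move=> c u v; rewrite linearP lf.
- by move=> c u v; rewrite linearP lg.
by move=> a b; rewrite phi_mono.
Qed.

(** The coefficient of [y ^+ b * x ^+ a]: the first index is the exponent of x, although x stands on
    the right. *)
Definition cf (a b : nat) (w : A) : k := mpoly.mcoeff (mn a b) (psi w).

Lemma cf_lin a b c u v : cf a b (c *: u + v) = c * cf a b u + cf a b v.
Proof. by rewrite /cf linearP mpoly.mcoeffD mpoly.mcoeffZ. Qed.

Lemma cf0 a b : cf a b 0 = 0.
Proof. by rewrite /cf linear0 mpoly.mcoeff0. Qed.

Lemma cfD a b u v : cf a b (u + v) = cf a b u + cf a b v.
Proof. by rewrite /cf linearD mpoly.mcoeffD. Qed.

Lemma cfB a b u v : cf a b (u - v) = cf a b u - cf a b v.
Proof. by rewrite /cf linearB mpoly.mcoeffB. Qed.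

Lemma cfN a b u : cf a b (- u) = - cf a b u.
Proof. by rewrite /cf linearN mpoly.mcoeffN. Qed.

Lemma cfZ a b c u : cf a b (c *: u) = c * cf a b u.
Proof. by rewrite /cf linearZ mpoly.mcoeffZ. Qed.

Lemma cf_M a b c d : cf a b (M c d) = ((c == a) && (d == b))%:R.
Proof. by rewrite /cf -phi_mono phiK mcoeff_mono. Qed.

Lemma cf_ext u v : (forall a b, cf a b u = cf a b v) -> u = v.
Proof.
move=> uv; apply: (can_inj psiK); apply/mpolyP => m; rewrite (mnE m).
exact: uv.
Qed.

Lemma cf_fun_ext (g h : A -> k) :
  (forall c u v, g (c *: u + v) = c * g u + g v) ->
  (forall c u v, h (c *: u + v) = c * h u + h v) ->
  (forall a b, g (M a b) = h (M a b)) -> g =1 h.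
Proof. by move=> lg lh; exact: (@pbw_ext k^o). Qed.

(** First of eight rules for multiplication by a generator. Multiplying by x on the left or by y on
    the right crosses the other variable and costs a power of q; on the other two sides the indices
    are only shifted. *)
Lemma cf_xl a b w : cf a.+1 b (x * w) = q ^+ b * cf a b w.
Proof.
apply: (cf_fun_ext (g := fun w => cf a.+1 b (x * w)) (h := fun w => q ^+ b * cf a b w)).
- by move=> c u v; rewrite alg_mulDr cf_lin.
- by move=> c u v; rewrite cf_lin mulrDr mulrCA.
move=> c d; rewrite xM cfZ !cf_M eqSS; case: eqP => //= [_|]; last by rewrite !mulr0.
by case: eqP => // [->|]; rewrite // !mulr0.
Qed.

Lemma cf_xl0 b w : cf 0 b (x * w) = 0.
Proof.
apply: (cf_fun_ext (g := fun w => cf 0 b (x * w)) (h := fun=> 0)).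
- by move=> c u v; rewrite alg_mulDr cf_lin.
- by move=> c u v; rewrite mulr0 addr0.
by move=> c d; rewrite xM cfZ cf_M mulr0.
Qed.

Lemma cf_xr a b w : cf a.+1 b (w * x) = cf a b w.
Proof.
apply: (cf_fun_ext (g := fun w => cf a.+1 b (w * x)) (h := cf a b)).
- by move=> c u v; rewrite alg_mulDl cf_lin.
- by move=> c u v; rewrite cf_lin.
by move=> c d; rewrite Mx !cf_M eqSS.
Qed.

Lemma cf_xr0 b w : cf 0 b (w * x) = 0.
Proof.
apply: (cf_fun_ext (g := fun w => cf 0 b (w * x)) (h := fun=> 0)).
- by move=> c u v; rewrite alg_mulDl cf_lin.
- by move=> c u v; rewrite mulr0 addr0.
by move=> c d; rewrite Mx cf_M.
Qed.

Lemma cf_yr a b w : cf a b.+1 (w * y) = q ^+ a * cf a b w.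
Proof.
apply: (cf_fun_ext (g := fun w => cf a b.+1 (w * y)) (h := fun w => q ^+ a * cf a b w)).
- by move=> c u v; rewrite alg_mulDl cf_lin.
- by move=> c u v; rewrite cf_lin mulrDr mulrCA.
move=> c d; rewrite My cfZ !cf_M eqSS; case: eqP => //= [->//|]; by rewrite !mulr0.
Qed.

Lemma cf_yr0 a w : cf a 0 (w * y) = 0.
Proof.
apply: (cf_fun_ext (g := fun w => cf a 0 (w * y)) (h := fun=> 0)).
- by move=> c u v; rewrite alg_mulDl cf_lin.
- by move=> c u v; rewrite mulr0 addr0.
by move=> c d; rewrite My cfZ cf_M andbF mulr0.
Qed.

Lemma cf_yl a b w : cf a b.+1 (y * w) = cf a b w.
Proof.
apply: (cf_fun_ext (g := fun w => cf a b.+1 (y * w)) (h := cf a b)).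
- by move=> c u v; rewrite alg_mulDr cf_lin.
- by move=> c u v; rewrite cf_lin.
by move=> c d; rewrite yM !cf_M eqSS.
Qed.

Lemma cf_yl0 a w : cf a 0 (y * w) = 0.
Proof.
apply: (cf_fun_ext (g := fun w => cf a 0 (y * w)) (h := fun=> 0)).
- by move=> c u v; rewrite alg_mulDr cf_lin.
- by move=> c u v; rewrite mulr0 addr0.
by move=> c d; rewrite yM cf_M andbF.
Qed.

Definition finsupp2 (F : nat -> nat -> k) : Prop :=
  exists n, forall a b, (n <= a + b)%N -> F a b = 0.

Lemma cf_finsupp w : finsupp2 (fun a b => cf a b w).
Proof.
exists (mmeasure mdeg (psi w)) => a b le_n; apply: memN_msupp_eq0.
apply: mmeasure_mnm_ge; apply: leq_trans le_n _.
rewrite -[leqRHS]/(mpoly.mdeg (mn a b)) mpoly.mdegE big_ord_recl big_ord1.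
by rewrite (_ : lift ord0 ord0 = ord_max) //; exact: val_inj.
Qed.

(** Case distinctions of this shape define the solutions of the coefficient equations for
    derivations. *)
Lemma finsupp2_if (P Q : nat -> nat -> bool) F G :
  finsupp2 F -> finsupp2 G ->
  finsupp2 (fun a b => if P a b then F a b : k else if Q a b then G a b else 0).
Proof.
move=> [n Fn] [m Gm]; exists (maxn n m) => a b; rewrite geq_max => /andP[hn hm].
by rewrite Fn // Gm // !if_same.
Qed.

Lemma finsupp2_shiftx w : finsupp2 (fun a b => cf a.+1 b w).
Proof.
by case: (cf_finsupp w) => n h; exists n => a b hn; apply: h; rewrite addSn leqW.
Qed.

Lemma finsupp2_shifty w : finsupp2 (fun a b => cf a b.+1 w).
Proof.
by case: (cf_finsupp w) => n h; exists n => a b hn; apply: h; rewrite addnS leqW.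
Qed.

Lemma finsupp2_mul (c : nat -> nat -> k) F :
  finsupp2 F -> finsupp2 (fun a b => c a b * F a b).
Proof. by case=> n h; exists n => a b hn; rewrite h ?mulr0. Qed.

(** Equations in the algebra can thus be solved one coefficient at a time, provided that the
    solution has finite support. *)
Lemma cf_ex F : finsupp2 F -> exists w, forall a b, cf a b w = F a b.
Proof.
case=> n Fn; exists (\sum_(a < n) \sum_(b < n) F a b *: M a b) => a b.
have cf_sum (r : nat) G : cf a b (\sum_(i < r) G i) = \sum_(i < r) cf a b (G i).
  by apply: (big_morph (cf a b)) => [u v|]; rewrite ?cfD ?cf0.
rewrite cf_sum; under eq_bigr => i _.
  rewrite cf_sum; under eq_bigr => j _ do rewrite cfZ cf_M.
  over.
case: (ltnP a n) => [lt_an|le_na]; last first.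
  rewrite Fn ?(leq_trans le_na) ?leq_addr // big1 // => i _; rewrite big1 // => j _.
  by rewrite (ltn_eqF (leq_trans (ltn_ord i) le_na)) mulr0.
case: (ltnP b n) => [lt_bn|le_nb]; last first.
  rewrite Fn ?(leq_trans le_nb) ?leq_addl // big1 // => i _; rewrite big1 // => j _.
  by rewrite (ltn_eqF (leq_trans (ltn_ord j) le_nb)) andbF mulr0.
rewrite (bigD1 (Ordinal lt_an)) //= [X in _ + X]big1 ?addr0; last first.
  by move=> i; rewrite -val_eqE /= => /negPf ->; rewrite big1 // => j _; rewrite mulr0.
rewrite (bigD1 (Ordinal lt_bn)) //= !eqxx mulr1 big1 ?addr0 //.
by move=> j; rewrite -val_eqE /= => /negPf ->; rewrite mulr0.
Qed.

Lemma cf_span (S : A -> Prop) w :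
  S 0 -> (forall c u v, S u -> S v -> S (c *: u + v)) ->
  (forall a b, cf a b w != 0 -> S (M a b)) -> S w.
Proof.
move=> S0 Sl; rewrite /cf -{2}[w]psiK; move: (psi w) => p Sp.
rewrite [p]mpolyE linear_sum /= big_seq_cond.
apply: (big_rec (fun z => S z)) => // m z; rewrite andbT => hm Sz.
rewrite linearZ /=; apply: Sl => //; rewrite (mnE m) -/(xymon _ _ _) phi_mono.
by apply: Sp; rewrite -mnE -mcoeff_msupp.
Qed.

End PBW.

(** * Centre and low-degree cochains *)

Section Center.
Variables (k : fieldType) (q : k) (A : algType k) (x y : A).
Variable B : pbw_basis q x y.
Local Notation cf := (cf B).
Local Notation M := (qmon x y).

Lemma central_gen c : c * x = x * c -> c * y = y * c -> c \in @central k A.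
Proof.
move=> cx cy; apply/centralP.
apply: (pbw_ext B (f := fun w => c * w) (g := fun w => w * c)).
- by move=> d u v; rewrite alg_mulDr.
- by move=> d u v; rewrite alg_mulDl.
move=> a b; apply: (@commrM A c); exact: commrX.
Qed.

Lemma central_cf c :
  reflect (forall a b, cf a b c != 0 -> q ^+ a = 1 /\ q ^+ b = 1) (c \in @central k A).
Proof.
apply: (iffP idP) => [/centralP cC a b nz|h].
  split; apply: (mulIf nz); rewrite mul1r.
    by have := congr1 (cf a b.+1) (cC y); rewrite cf_yr cf_yl.
  by have := congr1 (cf a.+1 b) (cC x); rewrite cf_xr cf_xl.
apply: central_gen; apply: (cf_ext (B := B)) => a b.
- case: a => [|a]; first by rewrite cf_xl0 cf_xr0.
  rewrite cf_xl cf_xr; case: (eqVneq (cf a b c) 0) => [->|/h[_ ->]].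
    by rewrite mulr0.
  by rewrite mul1r.
- case: b => [|b]; first by rewrite cf_yl0 cf_yr0.
  rewrite cf_yl cf_yr; case: (eqVneq (cf a b c) 0) => [->|/h[-> _]].
    by rewrite mulr0.
  by rewrite mul1r.
Qed.

Lemma central_ex F : finsupp2 F ->
  (forall a b, F a b != 0 -> q ^+ a = 1 /\ q ^+ b = 1) ->
  exists c : alg_center A, forall a b, cf a b (val c) = F a b.
Proof.
move=> fF hF; have [c cE] := cf_ex B fF.
have cC : c \in @central k A by apply/central_cf => a b; rewrite cE; apply: hF.
by exists (exist _ c cC).
Qed.

Lemma center_scalars : (forall N : nat, (0 < N)%N -> q ^+ N != 1) ->
  forall c, c \in @central k A -> c = (cf 0 0 c)%:A.
Proof.
move=> nr c /central_cf h; apply: (cf_ext (B := B)) => a b.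
rewrite cfZ -(M00 x y) cf_M.
have [ab|ab] := boolP ((0%N == a) && (0%N == b)).
  by case/andP: ab => /eqP <- /eqP <-; rewrite mulr1.
rewrite mulr0; apply/eqP; apply: contraNT ab => /h[qa qb].
case: a qa => [|a] qa; last by have := nr a.+1 isT; rewrite qa eqxx.
by case: b qb => [|b] qb; last by have := nr b.+1 isT; rewrite qb eqxx.
Qed.

Lemma center_not_root : (forall N : nat, (0 < N)%N -> q ^+ N != 1) ->
  [set c : A | c \in @central k A] = [set c : A | exists a : k, c = a%:A].
Proof.
move=> nr; apply/seteqP; split=> c /=.
  by move/(center_scalars nr) => cE; exists (cf 0 0 c).
by case=> a ->; apply/centralP => u; rewrite mulr_algl mulr_algr.
Qed.

Lemma center_primitive N : N.-primitive_root q ->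
  [set c : A | c \in @central k A] =
    smallest (@subalgebra k A) [set x ^+ N; y ^+ N].
Proof.
move=> pN; rewrite eqEsubset; split=> c /=.
  move=> /central_cf h S [[S1 Sl SM] SX].
  have Sx : S (x ^+ N) by apply: SX; left.
  have Sy : S (y ^+ N) by apply: SX; right.
  have S0 : S 0.
    by have := Sl (-1) 1 1 S1 S1; rewrite scaleN1r addNr.
  have SXn u n : S u -> S (u ^+ n).
    by move=> Su; elim: n => [|n IH]; rewrite ?expr0 ?exprS //; apply: SM.
  apply: (cf_span (B := B)) => // a b /h[/eqP + /eqP].
  (* Both exponents are multiples of N, so every monomial in the support is a product of powers of
     the two generators. *)
  rewrite -!(prim_order_dvd pN) => /dvdnP[i ->] /dvdnP[j ->].
  by rewrite /qmon mulnC exprM [(i * _)%N]mulnC exprM; apply: SM; apply: SXn.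
move/(_ [set c | c \in @central k A]); apply; split.
  case: (@central_subalg k A) => h1 h2 h3.
  by split=> [|d u v|u v] /=; [exact: h1|exact: h2|exact: h3].
have qN : q ^+ N = 1 by exact: prim_expr_order.
have xN : x ^+ N = M N 0 by rewrite /qmon expr0 mul1r.
have yN : y ^+ N = M 0 N by rewrite /qmon expr0 mulr1.
move=> _ [->|->] /=; apply/central_cf => a b; rewrite ?xN ?yN cf_M.
  by case: (_ =P a) => [<-|]; case: (_ =P b) => [<-|]; rewrite ?eqxx // expr0.
by case: (_ =P a) => [<-|]; case: (_ =P b) => [<-|]; rewrite ?eqxx // expr0.
Qed.

End Center.

(** * Derivations that scale the monomials *)

Section EulerDerivations.
Variables (k : fieldType) (q : k) (A : algType k) (x y : A).
Variable B : pbw_basis q x y.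
Local Notation M := (qmon x y).
Variable w : nat -> nat -> nat.
Hypothesis wD : forall a b c d, w (a + c) (b + d) = (w a b + w c d)%N.

Definition weight_map (u : A) : A :=
  linext (fun a b => (w a b)%:R *: M a b) (pbw_psi B u).

Lemma weight_map_linear : linear weight_map.
Proof. by move=> c u v; rewrite /weight_map !linearP. Qed.

HB.instance Definition _ := GRing.isLinear.Build k A A _ weight_map weight_map_linear.

Lemma weight_mapM a b : weight_map (M a b) = (w a b)%:R *: M a b.
Proof. by rewrite /weight_map -(pbw_mono B) pbw_phiK linext_mono pbw_mono. Qed.

(** A product of monomials is a multiple of the monomial with added exponents, so the Leibniz rule
    is the additivity of [w]. The two exponents, taken as weights, give x d_x and y d_y. *)
Lemma weight_map_der u v : weight_map (u * v) = weight_map u * v + u * weight_map v.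
Proof.
move: u; apply: (pbw_ext B (f := fun u => weight_map (u * v))
  (g := fun u => weight_map u * v + u * weight_map v)).
- by move=> c u u'; rewrite alg_mulDl linearP.
- move=> c u u'; rewrite linearP /= !alg_mulDl scalerDr addrACA //.
move=> a b; move: v; apply: (pbw_ext B (f := fun v => weight_map (M a b * v))
  (g := fun v => weight_map (M a b) * v + M a b * weight_map v)).
- by move=> c u u'; rewrite alg_mulDr linearP.
- move=> c u u'; rewrite linearP /= !alg_mulDr scalerDr addrACA //.
move=> c d; rewrite (MM B) linearZ /= !weight_mapM -scalerAl -scalerAr (MM B).
by rewrite -scalerDl wD natrD !scalerA mulrC.
Qed.

Definition weight_derivation : derivation A := Derivation weight_map_der.

End EulerDerivations.

Lemma euler_derivations (k : fieldType) (q : k) (A : algType k) (x y : A) :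
  pbw_basis q x y ->
  exists Dx Dy : derivation A, [/\ Dx x = x, Dx y = 0, Dy x = 0 & Dy y = y].
Proof.
move=> B; have w0D (a b c d : nat) : (a + c = a + c)%N by [].
have w1D (a b c d : nat) : (b + d = b + d)%N by [].
exists (weight_derivation B (w := fun a _ => a) w0D).
exists (weight_derivation B (w := fun _ b => b) w1D).
have X (w : nat -> nat -> nat) : weight_map B w x = (w 1%N 0%N)%:R *: x.
  by have := weight_mapM B w 1 0; rewrite M10.
have Y (w : nat -> nat -> nat) : weight_map B w y = (w 0%N 1%N)%:R *: y.
  by have := weight_mapM B w 0 1; rewrite M01.
by split; rewrite /= ?X ?Y ?scale1r ?scale0r.
Qed.

(** * Explicit coboundaries in low degree *)

Section LowDegree.
Variables (k : fieldType) (A : algType k).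
Local Notation cochain n := ({ffun 'I_n -> A} -> A).

Definition pair_ffun (u v : A) : {ffun 'I_2 -> A} := [ffun i => if i == ord0 then u else v].

Definition triple_ffun (u v w : A) : {ffun 'I_3 -> A} :=
  [ffun i : 'I_3 => if i == ord0 then u else if i == ord_max then w else v].

Lemma ffun1E (a : {ffun 'I_1 -> A}) : a = [ffun=> a ord0].
Proof. by apply/ffunP => i; rewrite ffunE (ord1 i). Qed.

Lemma ffun2E (a : {ffun 'I_2 -> A}) : a = pair_ffun (a ord0) (a ord_max).
Proof. by apply/ffunP => i; rewrite ffunE; case: (ord2P i) => ->. Qed.

Definition ord31 : 'I_3 := lift ord0 ord0.

Lemma ffun3E (a : {ffun 'I_3 -> A}) : a = triple_ffun (a ord0) (a ord31) (a ord_max).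
Proof.
apply/ffunP => i; rewrite ffunE; case: eqP => [->//|/eqP n0].
case: eqP => [->//|/eqP n2]; congr (a _); apply: val_inj.
by case: i n0 n2 => [[|[|[|i]]]].
Qed.

Lemma hochdE0 (f : cochain 0) a :
  hochd *%R f a = a ord0 * f [ffun i => 0] - f [ffun i => 0] * a ord0.
Proof.
rewrite /hochd big_ord0 addr0 expr1 scaleN1r (_ : ord_max = ord0); last exact: val_inj.
by congr (_ * f _ - f _ * _); apply/ffunP; case.
Qed.

Lemma hochdE1 (mu : A -> A -> A) (f : cochain 1) a :
  hochd mu f a = mu (a ord0) (f [ffun=> a ord_max]) - f [ffun=> mu (a ord0) (a ord_max)]
    + mu (f [ffun=> a ord0]) (a ord_max).
Proof.
rewrite /hochd big_ord1 expr1 scaleN1r sqrrN expr1n scale1r.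
have h1 : lift ord0 ord0 = ord_max :> 'I_2 by exact: val_inj.
have h2 : widen_ord (leqnSn 1) ord0 = ord0 by exact: val_inj.
congr (mu _ (f _) - f _ + mu (f _) _); apply/ffunP => i; rewrite !ffunE (ord1 i) //= ?h2 ?h1 //.
Qed.

Lemma hochdE2 (mu : A -> A -> A) (f : cochain 2) u v w :
  hochd mu f (triple_ffun u v w) =
    mu u (f (pair_ffun v w)) - f (pair_ffun (mu u v) w) + f (pair_ffun u (mu v w))
    - mu (f (pair_ffun u v)) w.
Proof.
rewrite /hochd !big_ord_recl big_ord0 /= expr1 !scaleN1r addr0.
rewrite -signr_odd /= expr0 scale1r -[(-1) ^+ 3]signr_odd /= expr1 scaleN1r addrA.
have e0 : triple_ffun u v w ord0 = u by rewrite ffunE.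
have e2 : triple_ffun u v w ord_max = w by rewrite ffunE.
have e1 (i : 'I_3) : val i = 1%N -> triple_ffun u v w i = v.
  by move=> hi; rewrite ffunE -!val_eqE /= hi.
have g0 (i : 'I_3) : val i = 0%N -> triple_ffun u v w i = u.
  by move=> hi; rewrite ffunE -!val_eqE /= hi.
have g2 (i : 'I_3) : val i = 2%N -> triple_ffun u v w i = w.
  by move=> hi; rewrite ffunE -!val_eqE /= hi.
congr (mu _ (f _) - f _ + f _ - mu (f _) _); rewrite ?e0 ?e2 //;
  apply/ffunP => i; rewrite !ffunE; case: (ord2P i) => ->; rewrite -?val_eqE /=;
  by rewrite ?(g0, e1, g2).
Qed.

Lemma multilinear1P (f : cochain 1) :
  multilinear f <-> linear (fun u => f [ffun=> u]).
Proof.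
split=> [mf c u v|lf i a c u v].
  have U w : [ffun=> w] = upd 0 ord0 w :> {ffun 'I_1 -> A}.
    by apply/ffunP => i; rewrite !ffunE (ord1 i) eqxx.
  by rewrite (U (c *: u + v)) mf -(U u) -(U v).
have U w : upd a i w = [ffun=> w].
  by apply/ffunP => j; rewrite !ffunE (ord1 i) (ord1 j) eqxx.
by rewrite !U lf.
Qed.

Lemma multilinear2P (f : cochain 2) :
  multilinear f <-> (forall v, linear (fun u => f (pair_ffun u v))) /\
                    (forall u, linear (fun v => f (pair_ffun u v))).
Proof.
have U0 u v w : upd (pair_ffun u v) ord0 w = pair_ffun w v.
  by apply/ffunP => i; rewrite !ffunE; case: eqP.
have U1 u v w : upd (pair_ffun u v) ord_max w = pair_ffun u w.
  by apply/ffunP => i; rewrite !ffunE; case: (ord2P i) => ->.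
split=> [mf|[l0 l1] i a c u v].
  split=> [v c u u'|u c v v'].
    by rewrite -(U0 0 v (c *: u + u')) mf !U0.
  by rewrite -(U1 u 0 (c *: v + v')) mf !U1.
rewrite (ffun2E a); case: (ord2P i) => ->; rewrite ?U0 ?U1.
  exact: l0.
exact: l1.
Qed.

Lemma cocycle1P (f : cochain 1) : is_cocycle f <->
  linear (fun u => f [ffun=> u]) /\
  forall u v, f [ffun=> u * v] = f [ffun=> u] * v + u * f [ffun=> v].
Proof.
split=> [[/multilinear1P lf df]|[lf df]].
  split=> // u v; have := congr1 (@^~ (pair_ffun u v)) df.
  rewrite hochdE1 !ffunE /= => /eqP; rewrite addrAC subr_eq0 addrC => /eqP.
  by move=> <-.
split; first exact/multilinear1P.
by apply/funext => a; rewrite hochdE1 df opprD addrCA subrr addr0 addNr.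
Qed.

End LowDegree.

Section Classes.
Variables (k : fieldType) (A : algType k).

Lemma coh_class_eq n (z w : cocycle A n) :
  coh_class z = coh_class w <-> is_coboundary (val z - val w).
Proof.
rewrite /coh_class; split=> [/eqP|h].
  by rewrite -Quotient.idealrBE => /asboolP; rewrite val_cocycleB.
by apply/eqP; rewrite -Quotient.idealrBE; apply/asboolP; rewrite val_cocycleB.
Qed.

Lemma coh_class_repr n (h : HH A n) : coh_class (repr h) = h.
Proof. exact: reprK. Qed.

End Classes.

(** * First cohomology *)

Section FirstCohomology.
Variables (k : fieldType) (q : k) (A : algType k) (x y : A).
Variable B : pbw_basis q x y.
Hypotheses (q_neq0 : q != 0) (q_neq1 : q != 1).
Local Notation cf := (cf B).
Local Notation M := (qmon x y).

Definition leibniz (g : A -> A) := forall u v, g (u * v) = g u * v + u * g v.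

(** The Leibniz rule carries the vanishing from the generators to powers and then to monomials; 1 *
    1 = 1 gives [g 1 = 0]. *)
Lemma leibniz_eq0 (g : A -> A) : linear g -> leibniz g ->
  g x = 0 -> g y = 0 -> forall w, g w = 0.
Proof.
move=> lg dg gx gy; apply: (pbw_ext B (g := fun=> 0)) => //.
  by move=> c u v; rewrite scaler0 addr0.
have g1 : g 1 = 0.
  by have /eqP := dg 1 1; rewrite !mulr1 mul1r -subr_eq0 opprD addrA subrr sub0r oppr_eq0 => /eqP.
have gX u n : g u = 0 -> g (u ^+ n) = 0.
  by move=> gu; elim: n => [|n IH]; rewrite ?expr0 // exprS dg gu IH mul0r mulr0 addr0.
by move=> a b; rewrite /qmon dg !gX // mul0r mulr0 addr0.
Qed.

Lemma leibniz_xy (g : A -> A) : linear g -> leibniz g ->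
  g x * y + x * g y = q *: (g y * x + y * g x).
Proof.
move=> lg dg; rewrite -!dg (pbw_xy B).
by have := lg q (y * x) 0; rewrite addr0 (linear_0 lg) addr0.
Qed.

Lemma linear_sub (f g : A -> A) : linear f -> linear g -> linear (fun u => f u - g u).
Proof. by move=> lf lg c u v; rewrite lf lg scalerBr opprD addrACA. Qed.

Lemma leibniz_sub (f g : A -> A) :
  leibniz f -> leibniz g -> leibniz (fun u => f u - g u).
Proof. by move=> df dg u v; rewrite df dg mulrBl mulrBr opprD addrACA. Qed.

Lemma linear_mull (a : A) (D : A -> A) : linear D -> linear (fun u => a * D u).
Proof. by move=> lD c u v; rewrite lD alg_mulDr. Qed.

Lemma leibniz_mull (c : alg_center A) (D : A -> A) :
  leibniz D -> leibniz (fun u => val c * D u).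
Proof.
move=> dD u v; rewrite dD mulrDr mulrA; congr (_ + _).
by rewrite !mulrA (centralP _ (valP c)).
Qed.

Lemma linear_inner (t : A) : linear (fun u => u * t - t * u).
Proof. by move=> c u v; rewrite alg_mulDl alg_mulDr scalerBr opprD addrACA. Qed.

Lemma leibniz_inner (t : A) : leibniz (fun u => u * t - t * u).
Proof.
move=> u v; rewrite mulrBl mulrBr !mulrA [RHS]addrC addrA.
by congr (_ - _); rewrite addrNK.
Qed.

Section Coefficients.
Variables (u v : A).
Hypothesis uv : u * y + x * v = q *: (v * x + y * u).

(** Here u and v stand for the images of x and y under a derivation, and [uv] is the differentiated
    relation. On the border only u * y and y * u contribute, so the coefficient equals q times
    itself. *)
Lemma koszul1_x b : cf 0 b u = 0.
Proof.
have := congr1 (cf 0 b.+1) uv.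
rewrite cfZ !cfD cf_yr cf_xl0 cf_xr0 cf_yl mul1r addr0 add0r => /eqP.
rewrite -subr_eq0 -{1}[cf 0 b u]mul1r -mulrBl mulf_eq0 subr_eq0 eq_sym.
by rewrite (negPf q_neq1) /= => /eqP.
Qed.

Lemma koszul1_y a : cf a 0 v = 0.
Proof.
have := congr1 (cf a.+1 0) uv.
rewrite cfZ !cfD cf_yr0 cf_xl cf_xr cf_yl0 mul1r addr0 add0r => /eqP.
rewrite -subr_eq0 -{1}[cf a 0 v]mul1r -mulrBl mulf_eq0 subr_eq0 eq_sym.
by rewrite (negPf q_neq1) /= => /eqP.
Qed.

(** The differentiated relation away from the border, divided by q. It is the compatibility that
    lets one element t correct both u and v. *)
Lemma koszul1_xy a b :
  (q ^+ a - 1) * cf a.+1 b u = (1 - q ^+ b) * cf a b.+1 v.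
Proof.
have := congr1 (cf a.+1 b.+1) uv.
rewrite cfZ !cfD cf_yr cf_xl cf_xr cf_yl !exprS -!mulrA -mulrDr => /(mulfI q_neq0).
by move/eqP; rewrite -subr_eq0 => /eqP h; apply/eqP; rewrite -subr_eq0 -h; apply/eqP; ring.
Qed.

Lemma koszul1_decomp : exists (c1 c2 : alg_center A) (t : A),
  u = val c1 * x + (x * t - t * x) /\ v = val c2 * y + (y * t - t * y).
Proof.
pose cond a b := (q ^+ a == 1) && (q ^+ b == 1).
have zero_supp : finsupp2 (fun _ _ => 0 : k) by exists 0%N.
(* The central coefficients collect the positions with q^a = q^b = 1, which inner derivations cannot
   reach. The idle inner test gives the expression the shape of [finsupp2_if]. *)
have [c1 c1E] : exists c : alg_center A,
    forall a b, cf a b (val c) = if cond a b then cf a.+1 b u else if false then 0 else 0.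
  apply: (central_ex B) => [|a b].
    exact: (finsupp2_if cond (fun _ _ => false) (finsupp2_shiftx B u) zero_supp).
  by rewrite /cond; case: ifP => [/andP[/eqP-> /eqP->]|] //; rewrite eqxx.
have [c2 c2E] : exists c : alg_center A,
    forall a b, cf a b (val c) = if cond a b then cf a b.+1 v else if false then 0 else 0.
  apply: (central_ex B) => [|a b].
    exact: (finsupp2_if cond (fun _ _ => false) (finsupp2_shifty B v) zero_supp).
  by rewrite /cond; case: ifP => [/andP[/eqP-> /eqP->]|] //; rewrite eqxx.
(* The inner derivation of t multiplies the coefficient of t at (a, b) by q^b - 1 in the image of x
   and by 1 - q^a in the image of y. So t is read off from u where q^b differs from 1, and otherwise
   from v where q^a does. *)
have [t tE] : exists t, forall a b, cf a b t =
    if q ^+ b != 1 then (q ^+ b - 1)^-1 * cf a.+1 b u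
    else if q ^+ a != 1 then (1 - q ^+ a)^-1 * cf a b.+1 v else 0.
  apply: cf_ex; apply: (finsupp2_if (fun a b => q ^+ b != 1) (fun a b => q ^+ a != 1)).
    exact: (finsupp2_mul (fun a b => (q ^+ b - 1)^-1) (finsupp2_shiftx B u)).
  exact: (finsupp2_mul (fun a b => (1 - q ^+ a)^-1) (finsupp2_shifty B v)).
exists c1, c2, t; split; apply: (cf_ext (B := B)).
  case=> [|a] b; rewrite cfD cfB; first by rewrite !cf_xr0 cf_xl0 subrr addr0 koszul1_x.
  rewrite !cf_xr cf_xl c1E tE /cond -[X in _ * _ - X]mul1r -mulrBl.
  have := koszul1_xy a b.
  case: (eqVneq (q ^+ b) 1) => [->|qb] /=.
    rewrite subrr mul0r => /eqP; rewrite mulf_eq0 subr_eq0.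
    by case: (eqVneq (q ^+ a) 1) => //= _; rewrite ?mul0r ?addr0 // => /eqP.
  by rewrite andbF add0r mulVKf // subr_eq0.
move=> a [|b]; rewrite cfD cfB; first by rewrite !cf_yr0 cf_yl0 subrr addr0 koszul1_y.
rewrite !cf_yr cf_yl c2E tE /cond -[X in X - _ * _]mul1r -mulrBl.
have := koszul1_xy a b.
case: (eqVneq (q ^+ a) 1) => [->|qa] /=.
  rewrite !subrr !mul0r addr0 mul1r => /esym /eqP; rewrite mulf_eq0 subr_eq0 eq_sym.
  by case: (eqVneq (q ^+ b) 1) => //= _ /eqP.
rewrite mulr0 add0r; case: (eqVneq (q ^+ b) 1) => [->|qb] /= h.
  by rewrite mulVKf // subr_eq0 eq_sym.
(* Both powers differ from 1: t was determined by u, and compatibility shows that it fits v as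
   well. *)
apply: (mulfI (_ : 1 - q ^+ b != 0)); first by rewrite subr_eq0 eq_sym.
rewrite -h -[q ^+ b - 1]opprB invrN mulNr !mulrN mulrCA mulVKf ?subr_eq0 1?eq_sym //.
by rewrite -mulNr opprB.
Qed.

End Coefficients.

(** The commutator of x with t carries the factor q^b - 1, which vanishes wherever a central element
    can have a nonzero coefficient. *)
Lemma inner_central (c : alg_center A) t : val c * x = x * t - t * x -> c = 0.
Proof.
move=> h; apply: val_inj; apply: (cf_ext (B := B)) => a b.
rewrite [RHS]cf0; apply/eqP; apply/negPn/negP => nz.
have [_ qb] := central_cf B (val c) (valP c) a b nz.
move: nz; have := congr1 (cf a.+1 b) h; rewrite cfB !cf_xr cf_xl qb mul1r subrr => ->.
by rewrite eqxx.
Qed.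

Lemma inner_centraly (c : alg_center A) t : val c * y = y * t - t * y -> c = 0.
Proof.
move=> h; apply: val_inj; apply: (cf_ext (B := B)) => a b.
rewrite [RHS]cf0; apply/eqP; apply/negPn/negP => nz.
have [qa _] := central_cf B (val c) (valP c) a b nz.
move: nz; have := congr1 (cf a b.+1) h; rewrite cfB !cf_yr cf_yl qa !mul1r subrr => ->.
by rewrite eqxx.
Qed.

Variables (Dx Dy : derivation A).
Hypotheses (Dxx : Dx x = x) (Dxy : Dx y = 0) (Dyx : Dy x = 0) (Dyy : Dy y = y).
Local Notation Z := (alg_center A).
Local Notation ex := (coh_class (der_cocycle Dx)).
Local Notation ey := (coh_class (der_cocycle Dy)).

Lemma scale_class n (c : Z) (z : cocycle A n) :
  c *: coh_class z = coh_class (ccocycle c z).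
Proof. exact: hh_scaleE. Qed.

Lemma HH1_generated (h : HH A 1) : exists c : Z * Z, h = c.1 *: ex + c.2 *: ey.
Proof.
rewrite -(coh_class_repr h); move: (repr h) => z.
have /asboolP/cocycle1P[lg dg] := valP z; set g := fun u => _ in lg.
have [c1 [c2 [t [gx gy]]]] := koszul1_decomp (leibniz_xy lg dg).
exists (c1, c2); rewrite !scale_class -coh_classD; apply/coh_class_eq => /=.
exists (fun=> t); first by case.
apply/funext => a; rewrite hochdE0 /=.
set c1D := fun u => val c1 * Dx u; set c2D := fun u => val c2 * Dy u.
set ad := fun u => u * t - t * u.
(* By the choice of c1, c2 and t this difference is a derivation that kills both generators. *)
have /(_ (a ord0)) : forall w, g w - c1D w - c2D w - ad w = 0.
  have lx : linear Dx by exact: linearP.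
  have ly : linear Dy by exact: linearP.
  apply: leibniz_eq0.
  - exact: linear_sub (linear_sub (linear_sub lg (linear_mull _ lx)) (linear_mull _ ly))
      (linear_inner t).
  - apply: leibniz_sub (leibniz_inner t).
    apply: leibniz_sub (leibniz_mull c2 (@derM _ _ Dy)).
    exact: leibniz_sub dg (leibniz_mull c1 (@derM _ _ Dx)).
  - by rewrite /c1D /c2D /ad Dxx Dyx mulr0 subr0 (gx : g x = _) [val c1 * x + _]addrC addrK subrr.
  - by rewrite /c1D /c2D /ad Dxy Dyy mulr0 subr0 (gy : g y = _) [val c2 * y + _]addrC addrK subrr.
move/eqP; rewrite subr_eq0 /ad => /eqP <-.
by rewrite /g /= -ffun1E -addrA -opprD.
Qed.

Lemma HH1_independent (c1 c2 : Z) : c1 *: ex + c2 *: ey = 0 -> c1 = 0 /\ c2 = 0.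
Proof.
rewrite !scale_class -coh_classD -[0](_ : coh_class 0 = 0); last exact: raddf0.
move/coh_class_eq => /= [f mf fE].
have E u : val c1 * Dx u + val c2 * Dy u = u * f [ffun=> 0] - f [ffun=> 0] * u.
  have := congr1 (@^~ [ffun=> u]) fE; rewrite hochdE0 !ffunE => <-.
  by rewrite /= /ccochain /der_cochain !fctE /= !ffunE subr0.
split.
  by apply: (inner_central (t := f [ffun=> 0])); rewrite -E Dxx Dyx mulr0 addr0.
by apply: (inner_centraly (t := f [ffun=> 0])); rewrite -E Dxy Dyy mulr0 add0r.
Qed.

Lemma HH1_free (h : HH A 1) : exists! c : Z * Z, h = c.1 *: ex + c.2 *: ey.
Proof.
have [c hc] := HH1_generated h; exists c; split=> // -[d1 d2] /= hd.
have /HH1_independent[] : (c.1 - d1) *: ex + (c.2 - d2) *: ey = 0.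
  by rewrite !scalerBl addrACA -opprD -hc hd subrr.
by move/subr0_eq => <- /subr0_eq <-; case: (c).
Qed.

Lemma HH1_scalars (h : HH A 1) : (forall N : nat, (0 < N)%N -> q ^+ N != 1) ->
  exists! c : k * k, h = (c.1%:A : Z) *: ex + (c.2%:A : Z) *: ey.
Proof.
move=> nr; have [[c d] [hcd U]] := HH1_free h.
have scal (e : Z) : e = (cf 0 0 (val e))%:A.
  by apply: val_inj; rewrite [LHS](center_scalars B nr (valP e)).
exists (cf 0 0 (val c), cf 0 0 (val d)); split=> [|[c' d'] /= h'].
  by rewrite /= -!scal.
have [-> ->] := U (c'%:A, d'%:A) h'.
by congr (_, _); rewrite /= cfZ -(M00 x y) cf_M mulr1.
Qed.

End FirstCohomology.

(** * Second cohomology *)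

Lemma addrACA3 (V : zmodType) (a a' b b' c c' : V) :
  a + a' + (b + b') + (c + c') = a + b + c + (a' + b' + c').
Proof. by rewrite (addrACA a) (addrACA (a + b)). Qed.

(* The multiplication depends on the cocycle, so the carrier has to mention it. *)
Definition sqext_of (k : fieldType) (A : algType k) (z : cocycle A 2) : Type :=
  (A * A)%type.

(** * The square-zero extension defined by a 2-cocycle *)

Section SquareZeroExtension.
Variables (k : fieldType) (A : algType k) (z : cocycle A 2).

Definition cval (u v : A) : A := val z (pair_ffun u v).

Lemma cval_multilinear : multilinear (val z).
Proof. by have /asboolP[] := valP z. Qed.

Lemma cval_linl v : linear (cval^~ v).
Proof. by have /multilinear2P[h _] := cval_multilinear; exact: h. Qed.

Lemma cval_linr u : linear (cval u).
Proof. by have /multilinear2P[_ h] := cval_multilinear; exact: h. Qed.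

Lemma cval_cocycle u v w :
  u * cval v w + cval u (v * w) = cval (u * v) w + cval u v * w.
Proof.
have /asboolP[_ dz] := valP z.
have := congr1 (@^~ (triple_ffun u v w)) dz; rewrite hochdE2 -!/(cval _ _).
by move/eqP; rewrite subr_eq0 addrAC subr_eq addrC => /eqP ->; rewrite addrC.
Qed.

Lemma cval1l v : cval 1 v = cval 1 1 * v.
Proof. by have := cval_cocycle 1 1 v; rewrite !mul1r => /addrI. Qed.

Lemma cval1r u : cval u 1 = u * cval 1 1.
Proof. by have := cval_cocycle u 1 1; rewrite !mulr1 => /addIr ->. Qed.

Local Notation sqext := (sqext_of z).
HB.instance Definition _ := GRing.Lmodule.copy sqext (A * A)%type.

Definition sq_mul (p r : sqext) : sqext :=
  (p.1 * r.1, p.1 * r.2 + p.2 * r.1 + cval p.1 r.1).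
(** The cocycle is not assumed to be normalized, whence the correction in the second component. *)
Definition sq_one : sqext := (1, - cval 1 1).

Lemma sq_eq (p r : sqext) : p.1 = r.1 -> p.2 = r.2 -> p = r.
Proof. by case: p r => ? ? [? ?] /= -> ->. Qed.

(** In the second component associativity is the cocycle identity. *)
Lemma sq_mulA : associative sq_mul.
Proof.
move=> p r s; apply: sq_eq => /=; first exact: mulrA.
rewrite !mulrDr !mulrDl !mulrA -!addrA; congr (_ + (_ + _)).
rewrite [in LHS]addrCA; congr (_ + _).
by rewrite cval_cocycle addrC.
Qed.

Lemma sq_mul1 : left_id sq_one sq_mul.
Proof.
move=> p; apply: sq_eq => /=; rewrite ?mul1r //.
by rewrite (cval1l p.1) mulNr addrNK.
Qed.

Lemma sq_mulr1 : right_id sq_one sq_mul.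
Proof.
move=> p; apply: sq_eq => /=; rewrite ?mulr1 //.
by rewrite (cval1r p.1) mulrN addrAC addNr add0r.
Qed.

Lemma sq_mul_linl (r : sqext) c (p s : sqext) :
  sq_mul (c *: p + s) r = c *: sq_mul p r + sq_mul s r.
Proof.
apply: sq_eq => /=; first exact: alg_mulDl.
by rewrite !alg_mulDl cval_linl addrACA3 !scalerDr.
Qed.

Lemma sq_mul_linr (r : sqext) c (p s : sqext) :
  sq_mul r (c *: p + s) = c *: sq_mul r p + sq_mul r s.
Proof.
apply: sq_eq => /=; first exact: alg_mulDr.
by rewrite !alg_mulDr cval_linr addrACA3 !scalerDr.
Qed.

Lemma sq_mulDl : left_distributive sq_mul +%R.
Proof. by move=> p s r; rewrite -[p]scale1r sq_mul_linl !scale1r. Qed.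

Lemma sq_mulDr : right_distributive sq_mul +%R.
Proof. by move=> r p s; rewrite -[p]scale1r sq_mul_linr !scale1r. Qed.

Lemma sq_one_neq0 : sq_one != 0.
Proof. by apply/eqP => /(congr1 fst)/eqP; rewrite oner_eq0. Qed.

HB.instance Definition _ := GRing.Zmodule_isNzRing.Build sqext
  sq_mulA sq_mul1 sq_mulr1 sq_mulDl sq_mulDr sq_one_neq0.

Lemma sq_mul0l (r : sqext) : sq_mul 0 r = 0.
Proof. exact: (mul0r (r : sqext)). Qed.

Lemma sq_scaleAl c (p r : sqext) : c *: (p * r) = (c *: p : sqext) * r.
Proof.
have := sq_mul_linl r c p 0; rewrite !addr0 sq_mul0l addr0 => h.
exact: esym h.
Qed.

HB.instance Definition _ := GRing.Lmodule_isLalgebra.Build k sqext sq_scaleAl.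

Lemma sq_scaleAr c (p r : sqext) : c *: (p * r) = p * (c *: r : sqext).
Proof.
have := sq_mul_linr p c r 0; rewrite !addr0.
by rewrite [sq_mul p 0](mulr0 (p : sqext)) addr0 => /esym.
Qed.

HB.instance Definition _ := GRing.LSemiAlgebra_isSemiAlgebra.Build k sqext sq_scaleAr.

Lemma sq_mulE (p r : sqext) :
  p * r = (p.1 * r.1, p.1 * r.2 + p.2 * r.1 + cval p.1 r.1).
Proof. by []. Qed.

End SquareZeroExtension.

Section Splitting.
Variables (k : fieldType) (q : k) (A : algType k) (x y : A).
Variable B : pbw_basis q x y.
Variables (z : cocycle A 2) (u v : A).
Hypothesis uv : x * v + u * y + cval z x y = q *: (y * u + v * x + cval z y x).

Definition lift_x : sqext_of z := (x, u).
Definition lift_y : sqext_of z := (y, v).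

Lemma lift_xy : lift_x * lift_y = q *: (lift_y * lift_x).
Proof. by apply: sq_eq => /=; [exact: pbw_xy|exact: uv]. Qed.

Definition splitting (w : A) : sqext_of z :=
  linext (fun a b => lift_y ^+ b * lift_x ^+ a) (pbw_psi B w).

Lemma splitting_linear : linear splitting.
Proof. by move=> c w w'; rewrite /splitting !linearP. Qed.

Lemma splitting_M a b : splitting (qmon x y a b) = lift_y ^+ b * lift_x ^+ a.
Proof. by rewrite /splitting -(pbw_mono B) pbw_phiK linext_mono. Qed.

(** Products of ordered monomials are computed from q-commutation alone, which the lifts of x and y
    satisfy by [lift_xy]. *)
Lemma splittingM w w' : splitting (w * w') = splitting w * splitting w'.
Proof.
move: w; apply: (pbw_ext B (f := fun w => splitting (w * w'))
  (g := fun w => splitting w * splitting w')).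
- by move=> c w1 w2; rewrite alg_mulDl splitting_linear.
- by move=> c w1 w2; rewrite splitting_linear alg_mulDl.
move=> a b; move: w'; apply: (pbw_ext B (f := fun w => splitting (qmon x y a b * w))
  (g := fun w => splitting (qmon x y a b) * splitting w)).
- by move=> c w1 w2; rewrite alg_mulDr splitting_linear.
- by move=> c w1 w2; rewrite splitting_linear alg_mulDr.
move=> c d; rewrite (MM B).
have := splitting_linear (q ^+ (a * d)) (qmon x y (a + c) (b + d)) 0.
rewrite addr0 (linear_0 splitting_linear) addr0 => ->; rewrite !splitting_M.
by rewrite (qcommM lift_xy).
Qed.

Lemma splitting1 w : (splitting w).1 = w.
Proof.
apply: (pbw_ext B (f := fun w => (splitting w).1) (g := id)) w => //.
  by move=> c w w'; rewrite splitting_linear.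
move=> a b; rewrite splitting_M sq_mulE /=.
have X n (p : sqext_of z) : (p ^+ n).1 = p.1 ^+ n.
  by elim: n => [|n IH]; rewrite ?expr0 // !exprS -IH.
by rewrite !X.
Qed.

(** The second component of a multiplicative section is a derivation up to the error term z, so z is
    the coboundary of its negative. *)
Lemma coboundary_of_koszul : is_coboundary (val z).
Proof.
have lg : linear (fun w => - (splitting w).2).
  by move=> c w w'; rewrite splitting_linear /= opprD scalerN.
exists (fun a => - (splitting (a ord0)).2).
  apply/multilinear1P => c w w'; rewrite !ffunE; exact: lg.
apply/funext => a; rewrite hochdE1 !ffunE splittingM sq_mulE /= !splitting1.
rewrite (ffun2E a) -/(cval _ _ _) !ffunE /= opprK mulrN mulNr.
set w0 := a ord0; set w1 := a ord_max.
by rewrite [RHS]addrAC -opprD addKr.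
Qed.

End Splitting.

Section SecondCohomology.
Variables (k : fieldType) (q : k) (A : algType k) (x y : A).
Variable B : pbw_basis q x y.
Hypotheses (q_neq0 : q != 0) (q_neq1 : q != 1) (two_neq0 : 2 != 0 :> k).
Local Notation cf := (cf B).
Local Notation Z := (alg_center A).

(** The value of the cocycle on the defining relation, which is what the Koszul resolution sees of
    it. *)
Definition koszul2 (z : cocycle A 2) : A := cval z x y - q *: cval z y x.

Lemma koszul2B (f g : cocycle A 2) : koszul2 (f - g) = koszul2 f - koszul2 g.
Proof. by rewrite /koszul2 /cval val_cocycleB !fctE scalerBr opprD addrACA -opprD. Qed.

Lemma koszul2_scale (c : Z) (z : cocycle A 2) : koszul2 (ccocycle c z) = val c * koszul2 z.
Proof. by rewrite /koszul2 /cval /= /ccochain scalerAr -mulrBr. Qed.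

Lemma koszul2_image (w : A) : cf 0 0 w = 0 ->
  (forall a b, q ^+ a = 1 -> q ^+ b = 1 -> cf a.+1 b.+1 w = 0) ->
  exists u v, q *: (y * u + v * x) - (x * v + u * y) = w.
Proof.
move=> w00 wab.
(* At (a+1, b+1) the equation reads q (1 - q^a) u + q (1 - q^b) v = w, in the coefficients of u at
   (a+1, b) and of v at (a, b+1). It is solved by u if q^a differs from 1, else by v. On the two
   borders a single unknown remains, with factor q - 1. *)
pose cU a := if a is a'.+1 then if q ^+ a' == 1 then 0 else (q * (1 - q ^+ a'))^-1
  else (q - 1)^-1.
pose cV a b := if b is b'.+1 then
  if (q ^+ a != 1) || (q ^+ b' == 1) then 0 else (q * (1 - q ^+ b'))^-1
  else (q - 1)^-1.
have [u uE] := cf_ex B (finsupp2_mul (fun a b => cU a) (finsupp2_shifty B w)).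
have [v vE] := cf_ex B (finsupp2_mul cV (finsupp2_shiftx B w)).
exists u, v; apply: (cf_ext (B := B)) => a b.
rewrite cfB cfZ !cfD.
case: a b => [|a] [|b].
- by rewrite cf_yl0 cf_xr0 cf_xl0 cf_yr0 !addr0 mulr0 subr0 w00.
- rewrite cf_yl cf_xr0 cf_xl0 cf_yr expr0 mul1r addr0 add0r uE /=.
  by rewrite -{2}[_^-1 * _]mul1r -mulrBl mulVKf // subr_eq0.
- rewrite cf_yl0 cf_xr cf_xl cf_yr0 expr0 mul1r addr0 add0r vE /=.
  by rewrite -{2}[_^-1 * _]mul1r -mulrBl mulVKf // subr_eq0.
rewrite cf_yl cf_xr cf_xl cf_yr uE vE /= !exprS.
case: (eqVneq (q ^+ a) 1) => [qa|qa] /=.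
  case: (eqVneq (q ^+ b) 1) => [qb|qb].
    by rewrite (wab _ _ qa qb) !mulr0 !addr0 mulr0 subr0.
  rewrite mul0r add0r !mulr0 addr0; have h : 1 - q ^+ b != 0 by rewrite subr_eq0 eq_sym.
  by field; rewrite q_neq0 h.
have h : 1 - q ^+ a != 0 by rewrite subr_eq0 eq_sym.
by rewrite mul0r mulr0 addr0 add0r; field; rewrite q_neq0 h.
Qed.

(** For the coboundary of g the values at x y and y x cancel by the relation. The remaining terms
    have factors q (1 - q^a) and q (1 - q^b), which vanish at these positions. *)
Lemma koszul2_coboundary z : is_coboundary (val z) ->
  forall a b, q ^+ a = 1 -> q ^+ b = 1 -> cf a.+1 b.+1 (koszul2 z) = 0.
Proof.
move=> [g /multilinear1P lg dg] a b qa qb; rewrite /koszul2 /cval dg !hochdE1 !ffunE /=.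
rewrite (pbw_xy B).
have -> : g [ffun=> q *: (y * x)] = q *: g [ffun=> y * x].
  by have := lg q (y * x) 0; rewrite addr0 (linear_0 lg) addr0.
rewrite cfB cfZ !cfD !cfN cfZ cf_xl cf_yr cf_yl cf_xr !exprS qa qb !mulr1.
by ring.
Qed.

Variables (Dx Dy : derivation A).
Hypotheses (Dxx : Dx x = x) (Dxy : Dx y = 0) (Dyx : Dy x = 0) (Dyy : Dy y = y).
Local Notation exy := (coh_class (wedge Dx Dy)).

Lemma koszul2_wedge : koszul2 (wedge Dx Dy) = q *: (y * x).
Proof.
rewrite /koszul2 /cval /= /wedge_cochain /cup_cochain !ffunE /= Dxx Dxy Dyx Dyy.
rewrite !mul0r subr0 sub0r (pbw_xy B) scalerN scalerN opprK !scalerA [q * _]mulrC.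
by rewrite -scalerDl -mulr2n -[_ *+ 2]mulr_natl mulrA mulfV // mul1r.
Qed.

(** Multiplying c by y on the right gives a factor q^a, which is 1 on the support of a central
    element. *)
Lemma cf_koszul2_cwedge (c : Z) a b :
  cf a.+1 b.+1 (koszul2 (ccocycle c (wedge Dx Dy))) = q * cf a b (val c).
Proof.
rewrite koszul2_scale koszul2_wedge -scalerAr cfZ mulrA cf_xr cf_yr.
have [->|nz] := eqVneq (cf a b (val c)) 0; first by rewrite mulr0.
by have [-> _] := central_cf B (val c) (valP c) a b nz; rewrite mul1r.
Qed.

Lemma cf00_koszul2_cwedge (c : Z) : cf 0 0 (koszul2 (ccocycle c (wedge Dx Dy))) = 0.
Proof.
rewrite koszul2_scale koszul2_wedge -scalerAr cfZ mulrA cf_xr0.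
by rewrite mulr0.
Qed.

Lemma HH2_torsion_free (c : Z) : c *: exy = 0 -> c = 0.
Proof.
rewrite scale_class -[0](_ : coh_class 0 = 0); last exact: raddf0.
move/coh_class_eq; rewrite subr0 => /koszul2_coboundary h.
apply: val_inj; apply: (cf_ext (B := B)) => a b.
rewrite [RHS]cf0; apply/eqP; apply/negPn/negP => nz.
have [qa qb] := central_cf B (val c) (valP c) a b nz.
have /eqP := h a b qa qb; rewrite cf_koszul2_cwedge mulf_eq0 (negPf q_neq0) /=.
by rewrite (negPf nz).
Qed.

Lemma HH2_generated (z : cocycle A 2) (e : k) : e != 0 -> koszul2 z = e%:A ->
  forall h : HH A 2, exists (a : k) (c : Z), h = (a%:A : Z) *: coh_class z + c *: exy.
Proof.
move=> e_neq0 zE h; rewrite -(coh_class_repr h); move: (repr h) => f.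
set w := koszul2 f; pose cond a b := (q ^+ a == 1) && (q ^+ b == 1).
have [c cE] : exists c : Z, forall a b,
    cf a b (val c) = (cond a b)%:R / q * cf a.+1 b.+1 w.
  apply: (central_ex B) => [|a b].
    apply: (finsupp2_mul (fun a b => (cond a b)%:R / q)).
    by case: (cf_finsupp B w) => n hn; exists n => a b le; apply: hn;
      rewrite addSn addnS !leqW.
  by rewrite /cond; case: (_ =P 1) => [->|]; case: (_ =P 1) => [->|] //;
    rewrite /= !mul0r eqxx.
(* The multiple of z removes the obstruction at the monomial 1, and c, divided by q in [cE], removes
   those at the positions with q^a = q^b = 1. *)
exists (cf 0 0 w / e), c; rewrite !scale_class -coh_classD; apply/coh_class_eq.
set w1 := w - (cf 0 0 w)%:A - koszul2 (ccocycle c (wedge Dx Dy)).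
have [u [v uv]] : exists u v, q *: (y * u + v * x) - (x * v + u * y) = w1.
  apply: koszul2_image => [|a b qa qb];
    rewrite /w1 (cfB B _ _ (w - _)) (cfB B _ _ w) (cfZ B _ _ (cf 0 0 w)) -(M00 x y) (cf_M B).
    by rewrite cf00_koszul2_cwedge mulr1 subrr subr0.
  rewrite cf_koszul2_cwedge cE /cond qa qb eqxx mulr0 subr0.
  by rewrite mulrA [q * (_ / q)]mulrCA mulfV // !mul1r subrr.
rewrite -val_cocycleB; apply: (coboundary_of_koszul B (u := u) (v := v)).
set F := f - _; rewrite scalerDr; move/eqP: uv; rewrite subr_eq => /eqP ->.
suff -> : w1 = koszul2 F by rewrite /koszul2 [RHS]addrAC subrK addrC.
rewrite /F opprD addrA !koszul2B koszul2_scale zE /w1; congr (_ - _ - _).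
by rewrite -scalerAl mul1r scalerA mulfVK.
Qed.

End SecondCohomology.

(** * Lifting the wedge of the partial derivatives *)

Section Bilinear.
Variable k : fieldType.
Local Notation P := (mpoly 2 k).
Local Notation mono := (@xymon k).

Definition bilin (K : nat -> nat -> nat -> nat -> P) (p r : P) : P :=
  linext (fun a b => linext (K a b) r) p.

Lemma bilin_linl K r : linear (bilin K ^~ r).
Proof. by move=> c p p'; rewrite /bilin linearP. Qed.

Lemma bilin_linr K p : linear (bilin K p).
Proof.
rewrite /bilin; elim/mono_ind: p => [|e a b p IH] c r r'.
  by rewrite !linear0 ?scaler0 ?addr0.
rewrite ![linext _ (e *: _ + _)]linearP /= !linext_mono linearP IH /=.
by rewrite !scalerDr !scalerA addrACA [e * c]mulrC.
Qed.

Lemma bilin0l K r : bilin K 0 r = 0.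
Proof. exact: linear_0 (bilin_linl K r). Qed.

Lemma bilin0r K p : bilin K p 0 = 0.
Proof. exact: linear_0 (bilin_linr K p). Qed.

Lemma bilin_mono K a b c d : bilin K (mono a b) (mono c d) = K a b c d.
Proof. by rewrite /bilin !linext_mono. Qed.

Lemma trilinear_eq0 (T : P -> P -> P -> P) :
  (forall r u, linear (fun p => T p r u)) -> (forall p u, linear (fun r => T p r u)) ->
  (forall p r, linear (T p r)) ->
  (forall a b c d e f, T (mono a b) (mono c d) (mono e f) = 0) ->
  forall p r u, T p r u = 0.
Proof.
move=> l1 l2 l3 T0 p r u; have z : linear (fun _ : P => 0 : P).
  by move=> c v w; rewrite scaler0 addr0.
apply: (mono_ext (l1 r u) z) => a b.
apply: (mono_ext (l2 (mono a b) u) z) => c d.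
exact: (mono_ext (l3 (mono a b) (mono c d)) z).
Qed.

Lemma linear_bigsum (I : finType) (U V : lmodType k) (F : I -> U -> V) :
  (forall i, linear (F i)) -> linear (fun p => \sum_i F i p).
Proof.
move=> lF c p p'; rewrite scaler_sumr -big_split /=.
by apply: eq_bigr => i _; rewrite lF.
Qed.

Lemma alternating_lin (V : lmodType k) (c : k) (x1 y1 x2 y2 x3 y3 x4 y4 : V) :
  (c *: x1 + y1) - (c *: x2 + y2) + (c *: x3 + y3) - (c *: x4 + y4) =
  c *: (x1 - x2 + x3 - x4) + (y1 - y2 + y3 - y4).
Proof.
rewrite !opprD (addrACA (c *: x1)) (addrACA (c *: x1 + _)) (addrACA (c *: x1 + _ + _)).
by rewrite !scalerDr !scalerN.
Qed.

(** For s n = E^n this is E^n [a] [d], with [a] the sum of E^(-i) over i < a. Leaving s arbitrary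
    covers the Taylor coefficients of E^n in h as well. *)
Definition rect_sum (s : int -> k) (n : int) (a d : nat) : k :=
  \sum_(i < a) \sum_(j < d) s (n - i%:Z - j%:Z).

Lemma rect_sum0l s n d : rect_sum s n 0 d = 0.
Proof. by rewrite /rect_sum big_ord0. Qed.

Lemma rect_sum0r s n a : rect_sum s n a 0 = 0.
Proof. by rewrite /rect_sum big1 // => i _; rewrite big_ord0. Qed.

Lemma rect_sumDl s n a c d :
  rect_sum s n (a + c) d = rect_sum s n a d + rect_sum s (n - a%:Z) c d.
Proof.
rewrite /rect_sum big_split_ord /=; congr (_ + _); apply: eq_bigr => i _.
by apply: eq_bigr => j _; rewrite PoszD opprD !addrA.
Qed.

Lemma rect_sumDr s n a d f :
  rect_sum s n a (d + f) = rect_sum s n a d + rect_sum s (n - d%:Z) a f.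
Proof.
rewrite /rect_sum -big_split /=; apply: eq_bigr => i _.
rewrite big_split_ord /=; congr (_ + _); apply: eq_bigr => j _.
by rewrite PoszD opprD addrA [n - _ - _]addrAC.
Qed.

(* With s n = E^n these are the structure constants of
   (1/2) (D_x (x) D_y - D_y (x) D_x), the partial derivatives being replaced by
   E-difference quotients; at E = 1 it is the wedge of the partial derivatives. *)
Definition lift_coef (s : int -> k) (a b c d : nat) : k :=
  2^-1 * (rect_sum s (a * d)%:Z a d - rect_sum s ((a * d)%:Z - a%:Z - d%:Z) b c).

Definition lift_kernel s a b c d : P :=
  lift_coef s a b c d *: mono (a + c).-1 (b + d).-1.

Definition star_kernel (s : int -> k) a b c d : P := s (a * d)%:Z *: mono (a + c) (b + d).

(** With [lift_coef0y], makes the truncated predecessors in [lift_kernel] harmless: an exponent sum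
    of 0 occurs only with coefficient 0. *)
Lemma lift_coef0x s b d : lift_coef s 0 b 0 d = 0.
Proof. by rewrite /lift_coef rect_sum0l rect_sum0r subrr mulr0. Qed.

Lemma lift_coef0y s a c : lift_coef s a 0 c 0 = 0.
Proof. by rewrite /lift_coef rect_sum0l rect_sum0r subrr mulr0. Qed.

Local Notation star_s s := (bilin (star_kernel s)).
Local Notation lift_s s := (bilin (lift_kernel s)).

(** Here and in the next three lemmas a term of the coboundary at three monomials becomes a scalar
    times one common monomial. The argument of s is a * (d + f - 1), written with integers; it
    matters only where d + f > 0. *)
Lemma star_lift_l s t a b c d e f :
  star_s s (mono a b) (lift_s t (mono c d) (mono e f)) =
  (s ((a * d)%:Z + (a * f)%:Z - a%:Z) * lift_coef t c d e f) *:
    mono (a + c + e).-1 (b + d + f).-1.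
Proof.
rewrite bilin_mono /lift_kernel.
have := bilin_linr (star_kernel s) (mono a b) (lift_coef t c d e f) (mono (c + e).-1 (d + f).-1) 0.
rewrite addr0 bilin0r addr0 => ->; rewrite bilin_mono /star_kernel.
have [ce|ce] := eqVneq (c + e)%N 0%N.
  move/eqP: ce; rewrite addn_eq0 => /andP[/eqP -> /eqP ->].
  by rewrite lift_coef0x mulr0 !scale0r.
have [df|df] := eqVneq (d + f)%N 0%N.
  move/eqP: df; rewrite addn_eq0 => /andP[/eqP -> /eqP ->].
  by rewrite lift_coef0y mulr0 !scale0r.
rewrite scalerA mulrC -!addnA.
case: (c + e)%N ce => // ce _; move dfE: (d + f)%N df => g; case: g dfE => // df dfE _.
rewrite !addnS /=; congr (s _ * _ *: _).
by rewrite -PoszD -mulnDr dfE mulnS PoszD addrC addKr.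
Qed.

Lemma star_lift_r s t a b c d e f :
  star_s s (lift_s t (mono a b) (mono c d)) (mono e f) =
  (s ((a * f)%:Z + (c * f)%:Z - f%:Z) * lift_coef t a b c d) *:
    mono (a + c + e).-1 (b + d + f).-1.
Proof.
rewrite bilin_mono /lift_kernel.
have := bilin_linl (star_kernel s) (mono e f) (lift_coef t a b c d) (mono (a + c).-1 (b + d).-1) 0.
rewrite addr0 bilin0l addr0 => ->; rewrite bilin_mono /star_kernel.
have [ac|ac] := eqVneq (a + c)%N 0%N.
  move/eqP: ac; rewrite addn_eq0 => /andP[/eqP -> /eqP ->].
  by rewrite lift_coef0x mulr0 !scale0r.
have [bd|bd] := eqVneq (b + d)%N 0%N.
  move/eqP: bd; rewrite addn_eq0 => /andP[/eqP -> /eqP ->].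
  by rewrite lift_coef0y mulr0 !scale0r.
rewrite scalerA mulrC.
case: (b + d)%N bd => // bd _; move acE: (a + c)%N ac => g; case: g acE => // ac acE _.
rewrite !addSn /=; congr (s _ * _ *: _).
by rewrite -PoszD -mulnDl acE mulSn PoszD addrC addKr.
Qed.

Lemma lift_star_l s t a b c d e f :
  lift_s t (star_s s (mono a b) (mono c d)) (mono e f) =
  (s (a * d)%:Z * lift_coef t (a + c) (b + d) e f) *: mono (a + c + e).-1 (b + d + f).-1.
Proof.
rewrite bilin_mono /star_kernel.
have := bilin_linl (lift_kernel t) (mono e f) (s (a * d)%:Z) (mono (a + c) (b + d)) 0.
rewrite addr0 bilin0l addr0 => ->.
by rewrite bilin_mono /lift_kernel scalerA.
Qed.

Lemma lift_star_r s t a b c d e f :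
  lift_s t (mono a b) (star_s s (mono c d) (mono e f)) =
  (s (c * f)%:Z * lift_coef t a b (c + e) (d + f)) *: mono (a + c + e).-1 (b + d + f).-1.
Proof.
rewrite bilin_mono /star_kernel.
have := bilin_linr (lift_kernel t) (mono a b) (s (c * f)%:Z) (mono (c + e) (d + f)) 0.
rewrite addr0 bilin0r addr0 => ->.
by rewrite bilin_mono /lift_kernel scalerA !addnA.
Qed.

Section Convolution.
Variables (I : finType) (s t : I -> int -> k) (sigma : int -> k).
(** Abstracts the law of exponents. With Taylor coefficients it is the Cauchy product at a fixed
    order in h; with a one-element index set it is E^n E^n' = E^(n + n'). *)
Hypothesis conv : forall n n', \sum_i s i n * t i n' = sigma (n + n').

Lemma conv_rect_sum m n a d :
  \sum_i s i m * rect_sum (t i) n a d = rect_sum sigma (m + n) a d.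
Proof.
rewrite /rect_sum; under eq_bigr do rewrite mulr_sumr.
rewrite exchange_big /=; apply: eq_bigr => j _.
under eq_bigr do rewrite mulr_sumr.
rewrite exchange_big /=; apply: eq_bigr => l _.
by rewrite conv !addrA.
Qed.

Lemma conv_lift_coef m a b c d :
  \sum_i s i m * lift_coef (t i) a b c d =
  2^-1 * (rect_sum sigma (m + (a * d)%:Z) a d
          - rect_sum sigma (m + ((a * d)%:Z - a%:Z - d%:Z)) b c).
Proof.
rewrite -!conv_rect_sum -sumrB mulr_sumr; apply: eq_bigr => i _.
by rewrite /lift_coef mulrCA mulrBr.
Qed.

Definition lift_cochain (t : int -> k) (a : {ffun 'I_2 -> P}) : P :=
  lift_s t (a ord0) (a ord_max).

Lemma lift_cochain_multilinear r : multilinear (lift_cochain r).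
Proof.
apply/multilinear2P; split=> u; rewrite /lift_cochain => c v w; rewrite !ffunE /=.
  exact: bilin_linl.
exact: bilin_linr.
Qed.

Lemma lift_identity a b c d e f :
  \sum_i (s i ((a * d)%:Z + (a * f)%:Z - a%:Z) * lift_coef (t i) c d e f
    - s i (a * d)%:Z * lift_coef (t i) (a + c) (b + d) e f
    + s i (c * f)%:Z * lift_coef (t i) a b (c + e) (d + f)
    - s i ((a * f)%:Z + (c * f)%:Z - f%:Z) * lift_coef (t i) a b c d) = 0.
Proof.
rewrite sumrB big_split sumrB /= !conv_lift_coef.
(* The exponent of E in the deformed product of the three monomials. All rectangles are referred to
   it or to N', the starting exponent of the second family. *)
pose N : int := (a * d)%:Z + (a * f)%:Z + (c * f)%:Z.
pose N' : int := N - a%:Z - c%:Z - f%:Z.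
have Se n n' u v : n = n' -> rect_sum sigma n u v = rect_sum sigma n' u v by move=> ->.
rewrite (Se _ (N - a%:Z) c f); last by rewrite /N; ring.
rewrite (Se _ N' d e); last by rewrite /N' /N; ring.
rewrite (Se _ N (a + c)%N f); last by rewrite /N mulnDl !PoszD; ring.
rewrite (Se _ N' (b + d)%N e); last by rewrite /N' /N mulnDl !PoszD; ring.
rewrite (Se _ N a (d + f)%N); last by rewrite /N mulnDr !PoszD; ring.
rewrite (Se _ (N' + c%:Z - d%:Z) b (c + e)%N); last by rewrite /N' /N mulnDr !PoszD; ring.
rewrite (Se _ (N - f%:Z) a d); last by rewrite /N; ring.
rewrite (Se _ (N' + c%:Z - d%:Z) b c); last by rewrite /N' /N; ring.
(* Each rectangle with a composite side is cut in two. The sums are reordered first so that the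
   pieces have matching starting exponents and cancel in pairs. *)
rewrite [(b + d)%N]addnC [(d + f)%N]addnC !rect_sumDl !rect_sumDr.
rewrite (Se (N' + c%:Z - d%:Z - c%:Z) (N' - d%:Z) b e); last by ring.
by ring.
Qed.

Definition star_mul (s : int -> k) : P -> P -> P := star_s s.

Lemma hochd_star_lift (a : {ffun 'I_3 -> P}) :
  \sum_i hochd (star_mul (s i)) (lift_cochain (t i)) a = 0.
Proof.
rewrite (ffun3E a); move: (a ord0) (a (ord31)) (a ord_max) => {a}.
apply: trilinear_eq0 => [r u|p u|p r|a b c d e f].
- apply: linear_bigsum => i e p p'; rewrite !hochdE2 /lift_cochain !ffunE /= /star_mul.
  by rewrite !bilin_linl alternating_lin.
- apply: linear_bigsum => i e r r'; rewrite !hochdE2 /lift_cochain !ffunE /= /star_mul.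
  by rewrite !(bilin_linl, bilin_linr) alternating_lin.
- apply: linear_bigsum => i e u u'; rewrite !hochdE2 /lift_cochain !ffunE /= /star_mul.
  by rewrite !bilin_linr alternating_lin.
under eq_bigr => i _.
  rewrite hochdE2 /lift_cochain !ffunE /= /star_mul.
  rewrite star_lift_l lift_star_l lift_star_r star_lift_r.
  rewrite -scalerBl -scalerDl -scalerBl.
  over.
by rewrite -scaler_suml lift_identity scale0r.
Qed.

End Convolution.
End Bilinear.

(** * The complex exponential series *)

Section ExponentialPartialSums.
Variable F : numFieldType.
Implicit Types u v : F.

Definition exp_sum n u : F := \sum_(i < n) u ^+ i / i`!%:R.

(* The part of the product of two partial sums outside the triangle i + j < n;
   its norm is bounded by the same real expression in the norms, which tends to
   0 because expR is multiplicative. *)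
Definition exp_defect n u v : F :=
  \sum_(i < n) \sum_(j < n | (n <= i + j)%N) (u ^+ i / i`!%:R) * (v ^+ j / j`!%:R).

Lemma fact_neq0 n : (n`!%:R : F) != 0.
Proof. by rewrite pnatr_eq0 -lt0n fact_gt0. Qed.

Lemma exp_term_conv m u v :
  \sum_(i < m.+1) (u ^+ i / i`!%:R) * (v ^+ (m - i) / (m - i)`!%:R) =
  (u + v) ^+ m / m`!%:R.
Proof.
rewrite addrC exprDn mulr_suml; apply: eq_bigr => i _.
have /(bin_fact)/(congr1 (fun n => n%:R : F)) : (i <= m)%N by rewrite -ltnS.
rewrite !natrM => <-; rewrite -mulr_natr; have := fact_neq0 i; have := fact_neq0 (m - i).
have : ('C(m, i)%:R : F) != 0 by rewrite pnatr_eq0 -lt0n bin_gt0 -ltnS.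
by move=> h1 h2 h3; field; rewrite h1 h2 h3.
Qed.

(** The product is a sum over a square of indices. Its part i + j < n, regrouped by m = i + j, is
    the partial sum at u + v by the binomial theorem. *)
Lemma exp_sumD n u v : exp_sum n (u + v) = exp_sum n u * exp_sum n v - exp_defect n u v.
Proof.
apply/eqP; rewrite eq_sym subr_eq; apply/eqP.
rewrite /exp_sum mulr_suml; under eq_bigr do rewrite mulr_sumr.
pose T i j := (u ^+ i / i`!%:R) * (v ^+ j / j`!%:R).
rewrite (eq_bigr (fun i : 'I_n => \sum_(j < n | (i + j < n)%N) T i j
    + \sum_(j < n | (n <= i + j)%N) T i j)); last first.
  move=> i _; rewrite (bigID (fun j : 'I_n => (i + j < n)%N)) /=; congr (_ + _).
  by apply: eq_bigl => j; rewrite -leqNgt.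
rewrite big_split /=; congr (_ + _).
transitivity (\sum_(m < n) \sum_(i < m.+1) T i (m - i)%N); last first.
  by apply: eq_bigr => m _; rewrite exp_term_conv.
have R1 (m : 'I_n) : \sum_(i < m.+1) T i (m - i)%N
    = \sum_(i < n | (i <= m)%N) T i (m - i)%N.
  by rewrite (big_ord_widen n (fun i => T i (m - i)%N)).
rewrite [RHS](eq_bigr _ (fun m _ => R1 m)) [RHS](exchange_big_dep predT) //=.
apply: eq_bigr => i _.
have R2 : \sum_(j < n | (i + j < n)%N) T i j = \sum_(0 <= j < n - i) T i j.
  rewrite big_mkord (big_ord_widen_cond n xpredT (fun j => T i j) (leq_subr i n)).
  by apply: eq_bigl => j; rewrite /= ltn_subRL.
rewrite R2.
have R3 : \sum_(m < n | (i <= m)%N) T i (m - i)%N = \sum_(i <= m < n) T i (m - i)%N.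
  rewrite -(big_mkord (fun m => i <= m)%N (fun m => T i (m - i)%N)).
  by rewrite [RHS](big_nat_widenl _ 0).
rewrite R3; have := big_addn 0 n i xpredT (fun m => T i (m - i)%N).
rewrite add0n => ->.
by apply: eq_bigr => j _; rewrite addnK.
Qed.

Lemma exp_defect_norm n u v : `|exp_defect n u v| <= exp_defect n `|u| `|v|.
Proof.
apply: le_trans (ler_norm_sum _ _ _) _; apply: ler_sum => i _.
apply: le_trans (ler_norm_sum _ _ _) _; apply: ler_sum => j _.
by rewrite !normrM !normfV !normrX !normr_nat.
Qed.

End ExponentialPartialSums.

Section ComplexExponential.
Variable R : realType.
Local Notation C := (R[i]%C).
Local Open Scope complex_scope.

Lemma cexp0 : cexp (0 : C) = 1.
Proof. by rewrite /cexp /= expR0 cos0 sin0 !mulr1 mulr0. Qed.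

Lemma cexpD (u v : C) : cexp (u + v) = cexp u * cexp v.
Proof.
case: u v => [a b] [c d]; rewrite /cexp /= expRD cosD sinD.
by apply/eqP; rewrite eq_complex /=; apply/andP; split; apply/eqP; ring.
Qed.

Lemma cexp_natr n (u : C) : cexp (u * n%:R) = cexp u ^+ n.
Proof.
elim: n => [|n IH]; first by rewrite mulr0 cexp0.
by rewrite exprSr -IH -cexpD -addn1 natrD mulrDr mulr1.
Qed.

(** [acos a] has a nonnegative sine, so its opposite is taken when b is negative. *)
Lemma cos_sin_ex (a b : R) : a ^+ 2 + b ^+ 2 = 1 -> exists t, cos t = a /\ sin t = b.
Proof.
move=> ab; have a1 : -1 <= a <= 1.
  by rewrite -ler_norml -(@ler_sqr _ `|a| 1) ?nnegrE // real_normK ?num_real // expr1n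
    -ab lerDl sqr_ge0.
have sE : Num.sqrt (1 - a ^+ 2) = `|b|.
  by rewrite -ab addrAC subrr add0r sqrtr_sqr.
case: (leP 0 b) => b0.
  by exists (acos a); rewrite sin_acos // acosK ?sE ?ger0_norm // in_itv.
exists (- acos a); rewrite cosN sinN sin_acos // acosK ?sE ?in_itv //.
by rewrite ltr0_norm // opprK.
Qed.

Lemma cexp_surj (q : C) : q != 0 -> exists h, cexp h = q.
Proof.
case: q => a b; rewrite eq_complex /= negb_and => ab.
have r2 : 0 < a ^+ 2 + b ^+ 2.
  case/orP: ab => h; first by rewrite ltr_pwDl ?sqr_ge0 // exprn_even_gt0.
  by rewrite ltr_wpDl ?sqr_ge0 // exprn_even_gt0.
pose r := Num.sqrt (a ^+ 2 + b ^+ 2); have r0 : 0 < r by rewrite sqrtr_gt0.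
have rE : r ^+ 2 = a ^+ 2 + b ^+ 2 by rewrite sqr_sqrtr // ltW.
have [t [ct st]] : exists t, cos t = a / r /\ sin t = b / r.
  apply: cos_sin_ex; rewrite !expr_div_n -mulrDl -rE mulfV //.
  by rewrite expf_neq0 // gt_eqF.
exists (ln r +i* t); rewrite /cexp /= lnK ?posrE // ct st.
by rewrite ![r * _]mulrC !divfK ?gt_eqF //.
Qed.

Lemma normc_real (x : R) : `|x%:C| = `|x|%:C.
Proof. by rewrite normc_def /= expr0n addr0 sqrtr_sqr. Qed.

Lemma posc_real (e : C) : 0 < e -> exists2 d : R, 0 < d & e = d%:C.
Proof. by case: e => a b; rewrite ltcE /= => /andP[/eqP -> a0]; exists a. Qed.

Lemma cvg_real_complex (u : nat -> R) (l : R) :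
  u @ \oo --> l -> (fun n => (u n)%:C : C^o) @ \oo --> (l%:C : C^o).
Proof.
move=> /cvgrPdist_lt ul; apply/cvgrPdist_lt => e /posc_real[d d0 ->].
by apply: filterS (ul d d0) => n; rewrite -rmorphB normc_real ltcR.
Qed.

Lemma cvg_complex (u : nat -> C) (l : C) :
  (fun n => complex.Re (u n)) @ \oo --> complex.Re l ->
  (fun n => complex.Im (u n)) @ \oo --> complex.Im l ->
  (u : nat -> C^o) @ \oo --> (l : C^o).
Proof.
move=> hr hi; rewrite (complexE l).
have -> : u = (fun n => (complex.Re (u n))%:C + 'i * (complex.Im (u n))%:C).
  by apply/funext => n; rewrite -complexE.
apply: cvgD; first exact: cvg_real_complex.
by apply: cvgMl_tmp; exact: cvg_real_complex.
Qed.

Lemma cvg_exp_sum_real (x : R) : (fun n => exp_sum n x) @ \oo --> expR x.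
Proof.
have -> : (fun n => exp_sum n x) = series (exp_coeff x).
  by apply/funext => n; rewrite /series /= big_mkord.
by rewrite /expR; exact: is_cvg_series_exp_coeff.
Qed.

Lemma cvg_exp_defect_real (a b : R) : (fun n => exp_defect n a b) @ \oo --> (0 : R).
Proof.
have -> : (fun n => exp_defect n a b) =
    (fun n => exp_sum n a * exp_sum n b - exp_sum n (a + b)).
  by apply/funext => n; rewrite exp_sumD subKr.
rewrite -[0 : R](subrr (expR (a + b))) {1}expRD.
by apply: cvgB; [apply: cvgM|]; exact: cvg_exp_sum_real.
Qed.

Lemma exp_sum_rmorph n (x : R) : exp_sum n (x%:C) = (exp_sum n x)%:C.
Proof.
rewrite /exp_sum rmorph_sum; apply: eq_bigr => i _.
by rewrite fmorph_div rmorphXn rmorph_nat.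
Qed.

Lemma exp_defect_rmorph n (x y : R) : exp_defect n x%:C y%:C = (exp_defect n x y)%:C.
Proof.
rewrite /exp_defect rmorph_sum; apply: eq_bigr => i _.
rewrite rmorph_sum; apply: eq_bigr => j _.
by rewrite rmorphM !fmorph_div !rmorphXn !rmorph_nat.
Qed.

Lemma cvg_exp_defect (u v : C) : (fun n => exp_defect n u v : C^o) @ \oo --> (0 : C^o).
Proof.
apply/cvgr0Pnorm_lt => e /posc_real[d d0 ->].
have [a aE] : exists a : R, `|u| = a%:C by rewrite normc_def; eexists.
have [b bE] : exists b : R, `|v| = b%:C by rewrite normc_def; eexists.
have /cvgr0Pnorm_lt/(_ _ d0) := cvg_exp_defect_real a b.
apply: filterS => n lt_d; apply: le_lt_trans (exp_defect_norm _ _ _) _.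
rewrite aE bE exp_defect_rmorph ltcR; exact: le_lt_trans (ler_norm _) lt_d.
Qed.

Lemma expi_term (t : R) n :
  ('i * t%:C) ^+ n / n`!%:R = cos_coeff t n +i* sin_coeff t n :> C.
Proof.
rewrite exprMn -rmorphXn -[n`!%:R](rmorph_nat (real_complex R)) -mulrA -fmorph_div.
(* Even powers of i are real and odd ones imaginary; the two exponents are those in the cosine and
   sine coefficients. *)
have iE : 'i ^+ n = (~~ odd n)%:R * (-1) ^+ n./2 +i* ((odd n)%:R * (-1) ^+ n.-1./2) :> C.
  rewrite -{1}[n]odd_double_half exprD -mul2n exprM sqr_i.
  have -> : (-1) ^+ n./2 = ((-1) ^+ n./2)%:C :> C by rewrite rmorphXn rmorphN1.
  case: (boolP (odd n)) => on /=.
    rewrite expr1; apply/eqP; rewrite eq_complex /= !mul0r mul1r !sub0r add0r oppr0.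
    rewrite !mul1r eqxx /=; apply/eqP; congr (_ ^+ _).
    by case: n on => //= n; rewrite uphalf_half => /negPf ->.
  by rewrite expr0 mul1r; apply/eqP; rewrite eq_complex /= !mul1r mul0r !eqxx.
rewrite iE /cos_coeff /sin_coeff /=; apply/eqP; rewrite eq_complex /=.
by rewrite !mulr0 subr0 add0r !mulrA !eqxx.
Qed.

Lemma cvg_exp_sum_imag (t : R) :
  (fun n => exp_sum n ('i * t%:C) : C^o) @ \oo --> (cos t +i* sin t : C^o).
Proof.
have E n : exp_sum n ('i * t%:C) = series (cos_coeff t) n +i* series (sin_coeff t) n :> C.
  rewrite /exp_sum /series /= !big_mkord; under eq_bigr do rewrite expi_term.
  elim: n => [|n IH]; first by rewrite !big_ord0.
  by rewrite !big_ord_recr IH.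
have -> : (fun n => exp_sum n ('i * t%:C)) =
    (fun n => series (cos_coeff t) n +i* series (sin_coeff t) n) by apply/funext.
apply: cvg_complex => /=.
- by rewrite unlock; exact: is_cvg_series_cos_coeff.
- by rewrite unlock; exact: is_cvg_series_sin_coeff.
Qed.

(** Connects [cexp], defined by real functions, with its series: [exp_sumD] separates the real and
    imaginary parts of w up to a defect that tends to 0. *)
Lemma cvg_exp_sum (w : C) : (fun n => exp_sum n w : C^o) @ \oo --> (cexp w : C^o).
Proof.
have -> : cexp w =
    (expR (complex.Re w))%:C * (cos (complex.Im w) +i* sin (complex.Im w)) - 0 :> C.
  by apply/eqP; rewrite subr0 /cexp eq_complex /= !mul0r subr0 addr0 !eqxx.
have -> : (fun n => exp_sum n w) = (fun n => exp_sum n (complex.Re w)%:C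
    * exp_sum n ('i * (complex.Im w)%:C)
    - exp_defect n (complex.Re w)%:C ('i * (complex.Im w)%:C)).
  by apply/funext => n; rewrite {1}(complexE w) exp_sumD.
apply: cvgB; last exact: cvg_exp_defect.
apply: cvgM; last exact: cvg_exp_sum_imag.
have -> : (fun n => exp_sum n (complex.Re w)%:C) =
    (fun n => (exp_sum n (complex.Re w))%:C) by apply/funext => n; rewrite exp_sum_rmorph.
by apply: cvg_real_complex; exact: cvg_exp_sum_real.
Qed.

End ComplexExponential.

(** * Specialization *)

Section LiftCocycle.
Variables (k : fieldType) (q : k) (A : algType k) (x y : A).
Variable B : pbw_basis q x y.
Variable s : int -> k.
Hypotheses (sD : forall n n', s n * s n' = s (n + n')) (s_nat : forall n : nat, s n%:Z = q ^+ n).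
Local Notation P := (mpoly 2 k).
Local Notation phi := (pbw_phi B).
Local Notation psi := (pbw_psi B).

Lemma phi_star p r : phi (star_mul s p r) = phi p * phi r.
Proof.
move: p; apply: (mono_ext (f := fun p => phi (star_mul s p r)) (g := fun p => phi p * phi r)).
- by move=> c p p'; rewrite /star_mul bilin_linl linearP.
- by move=> c p p'; rewrite linearP alg_mulDl.
move=> a b; move: r.
apply: (mono_ext (f := fun r => phi (star_mul s (xymon k a b) r))
  (g := fun r => phi (xymon k a b) * phi r)).
- by move=> c p p'; rewrite /star_mul bilin_linr linearP.
- by move=> c p p'; rewrite linearP alg_mulDr.
move=> c d; rewrite /star_mul bilin_mono /star_kernel linearZ /= !(pbw_mono B) (MM B).
by rewrite s_nat.
Qed.

Definition lift_spec (a : {ffun 'I_2 -> A}) : A :=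
  phi (lift_cochain s [ffun i => psi (a i)]).

Lemma lift_spec_pair p r : lift_spec (pair_ffun p r) = phi (bilin (lift_kernel s) (psi p) (psi r)).
Proof. by rewrite /lift_spec /lift_cochain !ffunE. Qed.

Lemma lift_spec_cocycle : is_cocycle lift_spec.
Proof.
split.
  apply/multilinear2P; split=> u c v w; rewrite !lift_spec_pair linearP.
    by rewrite bilin_linl linearP.
  by rewrite bilin_linr linearP.
apply/funext => a; rewrite (ffun3E a).
move: (a ord0) (a ord31) (a ord_max) => u v w {a}.
(* The specialized cocycle condition is the convolution argument over a one-element index set. *)
have conv n n' : \sum_(i < 1) s n * s n' = s (n + n') by rewrite big_ord1 sD.
have H := hochd_star_lift conv (triple_ffun (psi u) (psi v) (psi w)).
rewrite big_ord1 in H; transitivity (phi (hochd (star_mul s) (lift_cochain s)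
  (triple_ffun (psi u) (psi v) (psi w)))); last by rewrite H linear0.
have psiM p r : psi (p * r) = star_mul s (psi p) (psi r).
  by rewrite -[RHS](pbw_phiK B) phi_star !(pbw_psiK B).
rewrite !hochdE2 !lift_spec_pair /lift_cochain !ffunE /= !psiM.
by rewrite linearB linearD linearB /= !phi_star !(pbw_psiK B).
Qed.

Definition lift_cocycle : cocycle A 2 := mkCocycle lift_spec_cocycle.

(** The values at (x, y) and (y, x) are q / 2 and -1 / 2. A nonzero constant here is what
    [HH2_generated] asks for. *)
Lemma koszul2_lift : (2 : k) != 0 -> koszul2 q x y lift_cocycle = q%:A.
Proof.
move=> two_neq0; rewrite /koszul2 /cval /= !lift_spec_pair.
have -> : psi x = xymon k 1 0 by have := pbw_psiM B 1 0; rewrite M10.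
have -> : psi y = xymon k 0 1 by have := pbw_psiM B 0 1; rewrite M01.
rewrite !bilin_mono /lift_kernel !linearZ /= !(pbw_mono B) M00.
rewrite /lift_coef /rect_sum !big_ord1 !big_ord0 !subr0 /= !sub0r.
rewrite muln1 mul0n !s_nat expr1 expr0 scalerN mulrN1 scaleNr opprK scalerA -scalerDl.
by rewrite [q * _]mulrC -mulr2n -[_ *+ 2]mulr_natl mulrA mulfV // mul1r.
Qed.

End LiftCocycle.

Lemma scale_lin (k : fieldType) (V : lmodType k) (e c : k) (u v : V) :
  e *: (c *: u + v) = c *: (e *: u) + e *: v.
Proof. by rewrite scalerDr !scalerA mulrC. Qed.

(** * Power series in the deformation parameter *)

Section FormalSeries.
Variable R : realType.
Local Notation C := (R[i]%C).
Local Notation P := (mpoly 2 C).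
Local Notation mono := (xymon C).

Lemma mpoly_cvg_lin (c : C) (u v : nat -> P) (p r : P) :
  mpoly_cvg u p -> mpoly_cvg v r -> mpoly_cvg (fun n => c *: u n + v n) (c *: p + r).
Proof.
move=> [[d hd] hu] [[e he] hv]; split.
  exists (maxn d e) => n; apply: leq_trans (mmeasureD_le _ _ _) _.
  by rewrite geq_max !leq_max (leq_trans (mmeasureZ_le _ _ _) (hd n)) he orbT.
move=> m; rewrite mpoly.mcoeffD mpoly.mcoeffZ.
have -> : (fun n => mpoly.mcoeff m (c *: u n + v n)) =
    (fun n => c * mpoly.mcoeff m (u n) + mpoly.mcoeff m (v n)).
  by apply/funext => n; rewrite mpoly.mcoeffD mpoly.mcoeffZ.
by apply: cvgD; [apply: cvgMl_tmp|]; [exact: hu|exact: hv].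
Qed.

Lemma mpoly_cvg_unique (u : nat -> P) (p r : P) :
  mpoly_cvg u p -> mpoly_cvg u r -> p = r.
Proof.
move=> [_ hp] [_ hr]; apply/mpolyP => m.
apply: (cvg_unique _ (hp m) (hr m)); exact: norm_hausdorff.
Qed.

Lemma mpoly_cvg_scale (s : nat -> C) (l : C) (p : P) :
  (s : nat -> C^o) @ \oo --> (l : C^o) -> mpoly_cvg (fun n => s n *: p) (l *: p).
Proof.
move=> sl; split.
  by exists (mmeasure mdeg p) => n; exact: mmeasureZ_le.
move=> m; rewrite mpoly.mcoeffZ.
have -> : (fun n => mpoly.mcoeff m (s n *: p)) = (fun n => s n * mpoly.mcoeff m p).
  by apply/funext => n; rewrite mpoly.mcoeffZ.
exact: cvgMr_tmp.
Qed.

Lemma psum_lin (h c : C) (u v : nat -> P) (p r : P) :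
  psum u h p -> psum v h r -> psum (fun n => c *: u n + v n) h (c *: p + r).
Proof.
move=> hu hv; have := mpoly_cvg_lin c hu hv; rewrite /psum.
congr mpoly_cvg; apply/funext => n; rewrite /series /= scaler_sumr -big_split /=.
by apply: eq_bigr => i _; rewrite scalerDr !scalerA mulrC.
Qed.

Lemma psum0 (h : C) : psum (fun=> 0 : P) h 0.
Proof.
rewrite /psum (_ : series _ = fun n => (0 : C) *: (0 : P)).
  by rewrite -[X in mpoly_cvg _ X](scaler0 _ 0); apply: mpoly_cvg_scale; exact: cvg_cst.
by apply/funext => n; rewrite /series /= scaler0 big1 // => i _; rewrite scaler0.
Qed.

Lemma psum_scale (h : C) (s : nat -> C) (l : C) (p : P) :
  (fun n => \sum_(i < n) h ^+ i * s i : C^o) @ \oo --> (l : C^o) ->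
  psum (fun i => s i *: p) h (l *: p).
Proof.
move=> sl; have := mpoly_cvg_scale p sl; rewrite /psum.
congr mpoly_cvg; apply/funext => n; rewrite /series /= big_mkord scaler_suml.
by apply: eq_bigr => i _; rewrite scalerA.
Qed.

Lemma psum_eq (h : C) (t t' : nat -> P) p p' :
  (forall i, t i = t' i) -> p = p' -> psum t' h p' -> psum t h p.
Proof. by move=> /funext -> ->. Qed.

(** Polynomials are finite combinations of monomials, so convergence need only be checked on
    structure constants. *)
Lemma psum_bilin (h : C) (K : nat -> nat -> nat -> nat -> nat -> P) K' p r :
  (forall a b c d, psum (fun i => K i a b c d) h (K' a b c d)) ->
  psum (fun i => bilin (K i) p r) h (bilin K' p r).
Proof.
move=> hK; elim/mono_ind: p => [|e a b p IHp].
  by apply: psum_eq (psum0 h) => [i|]; exact: bilin0l.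
apply: psum_eq (psum_lin e _ IHp) => [i||]; [exact: bilin_linl|exact: bilin_linl|].
elim/mono_ind: r {IHp} => [|f c d r IHr].
  by apply: psum_eq (psum0 h) => [i|]; exact: bilin0r.
apply: psum_eq (psum_lin f (hK a b c d) IHr) => [i|].
  by rewrite bilin_linr bilin_mono.
by rewrite bilin_linr bilin_mono.
Qed.

(* Coefficient of h^i in e^(hn). *)
Definition exp_coefz (i : nat) (n : int) : C := n%:~R ^+ i / i`!%:R.

Definition cexpz (h : C) (n : int) : C := cexp (h * n%:~R).

Lemma cvg_exp_coefz (h : C) (n : int) :
  (fun m => \sum_(i < m) h ^+ i * exp_coefz i n : C^o) @ \oo --> (cexpz h n : C^o).
Proof.
rewrite (_ : (fun m => _) = fun m => exp_sum m (h * n%:~R)); first exact: cvg_exp_sum.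
by apply/funext => m; apply: eq_bigr => i _; rewrite exprMn mulrA.
Qed.

Lemma psum_star (h : C) p r :
  psum (fun i => star_mul (exp_coefz i) p r) h (star_mul (cexpz h) p r).
Proof. by apply: psum_bilin => a b c d; apply: psum_scale; exact: cvg_exp_coefz. Qed.

Lemma cvg_rect_sum (h : C) n a d :
  (fun m => \sum_(i < m) h ^+ i * rect_sum (exp_coefz i) n a d : C^o) @ \oo -->
    (rect_sum (cexpz h) n a d : C^o).
Proof.
rewrite (_ : (fun m => _) = fun m => rect_sum (fun n => \sum_(i < m) h ^+ i * exp_coefz i n) n a d).
  apply: cvg_big => [|i _]; first exact: add_continuous.
  by apply: cvg_big => [|j _]; [exact: add_continuous|exact: cvg_exp_coefz].
apply/funext => m; rewrite /rect_sum; under eq_bigr do rewrite mulr_sumr.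
rewrite exchange_big /=; apply: eq_bigr => i _.
under eq_bigr do rewrite mulr_sumr.
by rewrite exchange_big.
Qed.

Lemma psum_lift (h : C) (a : {ffun 'I_2 -> P}) :
  psum (fun i => lift_cochain (exp_coefz i) a) h (lift_cochain (cexpz h) a).
Proof.
apply: psum_bilin => a0 b c d; apply: psum_scale; rewrite /lift_coef.
rewrite (_ : (fun m => _) = fun m => 2^-1 *
  (\sum_(i < m) h ^+ i * rect_sum (exp_coefz i) (a0 * d)%:Z a0 d
  - \sum_(i < m) h ^+ i * rect_sum (exp_coefz i) ((a0 * d)%:Z - a0%:Z - d%:Z) b c)).
  by apply: cvgMl_tmp; apply: cvgB; exact: cvg_rect_sum.
apply/funext => m; rewrite -sumrB mulr_sumr; apply: eq_bigr => i _.
by rewrite mulrCA mulrBr.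
Qed.

Lemma exp_coefz_conv m n n' :
  \sum_(i < m.+1) exp_coefz i n * exp_coefz (m - i) n' = exp_coefz m (n + n').
Proof. by rewrite exp_term_conv -rmorphD. Qed.

Lemma cexpzD (h : C) n n' : cexpz h n * cexpz h n' = cexpz h (n + n').
Proof. by rewrite /cexpz rmorphD mulrDr cexpD. Qed.

Lemma cexpz_nat (h : C) (n : nat) : cexpz h n%:Z = cexp h ^+ n.
Proof. exact: cexp_natr. Qed.

Lemma linear_iter (V : lmodType C) n (f : V -> V) : linear f -> linear (iter n f).
Proof. by move=> lf; elim: n => // n IH c u v; rewrite !iterS IH lf. Qed.

Lemma mono_shift (i : 'I_2) a b :
  (mn a b i)%:R *: (poly_var R i * mpolyX C (mnm_sub (mn a b) (mnm1 i))) =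
  (mn a b i)%:R *: mono a b.
Proof.
have [->|nz] := eqVneq (mn a b i) 0%N; first by rewrite !scale0r.
by rewrite /poly_var -mpolyXD addmC submK // lep1mP.
Qed.

Lemma euler_linear i : linear (@euler R i).
Proof.
by move=> c u v; rewrite /euler -[mderiv i (_ + _)]/(partial R i (_ + _)) linearP /= alg_mulDr.
Qed.

Lemma euler_mono i a b : euler i (mono a b) = (mn a b i)%:R *: mono a b.
Proof. by rewrite /euler /xymon mderivX -scalerAr mono_shift. Qed.

Lemma iter_euler_mono i n a b : iter n (@euler R i) (mono a b) = (mn a b i)%:R ^+ n *: mono a b.
Proof.
elim: n => [|n IH]; first by rewrite scale1r.
rewrite /= IH; have := euler_linear i ((mn a b i)%:R ^+ n) (mono a b) 0.
by rewrite addr0 (linear_0 (euler_linear i)) addr0 euler_mono scalerA => ->; rewrite exprSr.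
Qed.

(** Monomials are eigenvectors of the Euler operators, so the term of order i multiplies them by (a
    d)^i / i!. *)
Lemma star_kernelE i : @star R i = star_mul (exp_coefz i).
Proof.
have l0 := linear_iter i (@euler_linear ord0); have l1 := linear_iter i (@euler_linear ord_max).
apply/funext => p; apply/funext => r; rewrite /star /star_mul; move: p.
apply: (mono_ext (f := fun p => _ *: (iter i (@euler R ord0) p * _)) (g := fun p => bilin _ p r)).
- move=> c p p'; apply: etrans (congr1 (fun z => _ *: (z * _)) (l0 c p p')) _.
  by apply: etrans (congr1 _ (alg_mulDl _ _ _ _)) (scale_lin _ _ _ _).
- exact: bilin_linl.
move=> a b; move: r.
apply: (mono_ext (f := fun r => _ *: (_ * iter i (@euler R ord_max) r)) (g := fun r => bilin _ _ r)).
- move=> c p p'; apply: etrans (congr1 (fun z => _ *: (_ * z)) (l1 c p p')) _.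
  by apply: etrans (congr1 _ (alg_mulDr _ _ _ _)) (scale_lin _ _ _ _).
- exact: bilin_linr.
move=> c d; rewrite bilin_mono !iter_euler_mono -scalerAl -scalerAr monoM !scalerA.
rewrite /star_kernel; apply: (congr1 (fun e => e *: mono (a + c) (b + d))).
by rewrite /exp_coefz -[_%:~R]/((a * d)%:R) natrM exprMn mn_0 mn_1; ring.
Qed.

Lemma rect_sum_const n a d : rect_sum (fun=> 1 : C) n a d = (a * d)%:R.
Proof.
rewrite /rect_sum; under eq_bigr do rewrite sumr_const card_ord.
by rewrite sumr_const card_ord -mulrnA mulnC.
Qed.

Lemma mderiv_mono i a b :
  mderiv i (mono a b) = (mn a b i)%:R *: mpolyX C (mnm_sub (mn a b) (mnm1 i)).
Proof. exact: mderivX. Qed.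

Lemma mderiv0_mono a b : mderiv ord0 (mono a b) = a%:R *: mono a.-1 b.
Proof.
rewrite mderiv_mono (_ : mnm_sub _ _ = mn a.-1 b) //.
apply/mnmP => i; rewrite mnmBE mnm1E.
by case: (ord2P i) => ->; rewrite ?mn_0 ?mn_1 /= ?subn1 ?subn0.
Qed.

Lemma mderiv1_mono a b : mderiv ord_max (mono a b) = b%:R *: mono a b.-1.
Proof.
rewrite mderiv_mono (_ : mnm_sub _ _ = mn a b.-1) //.
apply/mnmP => i; rewrite mnmBE mnm1E.
by case: (ord2P i) => ->; rewrite ?mn_0 ?mn_1 /= ?subn1 ?subn0.
Qed.

(** At order 0 every power of E contributes 1, so the rectangle sums become the areas a d and b c,
    the factors produced by the partial derivatives. *)
Lemma lift_cochain0 :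
  lift_cochain (exp_coefz 0) = val (wedge (partial R ord0) (partial R ord_max)).
Proof.
set z := wedge _ _; have mz : multilinear (val z) by have /asboolP[] := valP z.
have /multilinear2P[l0 l1] := mz.
have /multilinear2P[m0 m1] := lift_cochain_multilinear (exp_coefz 0).
apply/funext => a; rewrite (ffun2E a); move: (a ord0) (a ord_max) => p r {a}.
move: p; apply: (mono_ext (m0 r) (l0 r)) => a b.
move: r; apply: (mono_ext (m1 _) (l1 _)) => c d.
rewrite /lift_cochain /= /wedge_cochain /cup_cochain !ffunE /= bilin_mono.
rewrite -[partial R ord0 _]/(mderiv ord0 _) -[partial R ord0 _]/(mderiv ord0 _).
rewrite -[partial R ord_max _]/(mderiv ord_max _) -[partial R ord_max _]/(mderiv ord_max _).
rewrite !mderiv0_mono !mderiv1_mono.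
have E : exp_coefz 0 = fun=> 1 by apply/funext => n; rewrite /exp_coefz expr0 fact0 divr1.
rewrite /lift_kernel /lift_coef E !rect_sum_const -scalerA scalerBl.
apply: (congr1 (fun p => 2^-1 *: p)); congr (_ - _).
  case: a d => [|a] [|d]; rewrite ?mul0n ?muln0 ?scale0r ?mul0r ?mulr0 //.
  by rewrite -scalerAl -scalerAr monoM scalerA -natrM !addnS !addSn.
case: b c => [|b] [|c]; rewrite ?mul0n ?muln0 ?scale0r ?mul0r ?mulr0 //.
by rewrite -scalerAl -scalerAr monoM scalerA -natrM !addnS !addSn.
Qed.

Lemma lift_formal : formal_lift (wedge (partial R ord0) (partial R ord_max))
  (fun i => lift_cochain (exp_coefz i)).
Proof.
split; first exact: lift_cochain0.
  by move=> j; exact: lift_cochain_multilinear.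
move=> m a; rewrite -[RHS](hochd_star_lift (exp_coefz_conv m) a).
by apply: eq_bigr => i _; rewrite star_kernelE.
Qed.

End FormalSeries.

Section Specialization.
Variables (R : realType) (h q : R[i]%C) (A : algType R[i]%C) (x y : A).
Variable B : pbw_basis q x y.
Hypothesis hq : cexp h = q.
Local Notation P := (mpoly 2 R[i]%C).
Local Notation phi := (pbw_phi B).

Lemma cexpz_q (n : nat) : cexpz h n%:Z = q ^+ n.
Proof. by rewrite cexpz_nat hq. Qed.

Lemma phi_var0 : phi (poly_var R ord0) = x.
Proof.
rewrite /poly_var (_ : mnm1 _ = mn 1 0); first exact: etrans (pbw_mono B 1 0) (M10 x y).
by apply/mnmP => i; rewrite mnm1E; case: (ord2P i) => ->.
Qed.

Lemma phi_var1 : phi (poly_var R ord_max) = y.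
Proof.
rewrite /poly_var (_ : mnm1 _ = mn 0 1); first exact: etrans (pbw_mono B 0 1) (M01 x y).
by apply/mnmP => i; rewrite mnm1E; case: (ord2P i) => ->.
Qed.

Lemma phi_psum_star (p r : P) :
  exists s, psum (fun i => star i p r) h s /\ phi s = phi p * phi r.
Proof.
exists (star_mul (cexpz h) p r); split; last exact: (phi_star B cexpz_q).
by apply: psum_eq (psum_star h p r) => // i; rewrite star_kernelE.
Qed.

Definition wedge_lift : cocycle A 2 := lift_cocycle B (cexpzD h) cexpz_q.

(** By uniqueness of limits s is the closed form of the series, from which the cocycle was built. *)
Lemma wedge_lift_psum (a : {ffun 'I_2 -> P}) s :
  psum (fun i => lift_cochain (exp_coefz R i) a) h s ->
  val wedge_lift [ffun i => phi (a i)] = phi s.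
Proof.
move=> hs; rewrite (mpoly_cvg_unique hs (psum_lift h a)) /= /lift_spec.
apply: (congr1 (fun b => phi (lift_cochain (cexpz h) b))).
by apply/ffunP => i; rewrite !ffunE pbw_phiK.
Qed.

End Specialization.

Lemma wqp_basis (k : fieldType) (q : k) : pbw_basis q (qp_x q) (qp_y q).
Proof.
exact: (@PBWBasis k q (Wqp q) (qp_x q) (qp_y q) (qp_xy q) (@qp_phi k q) (@qp_psi k q)
  (@phiK k q) (@psiK k q) (@phi_mono k q)).
Qed.

Lemma wedge_lift_is_lift (R : realType) (h q : R[i]%C) (hq : cexp h = q) :
  is_lift (wedge (partial R ord0) (partial R ord_max)) (wedge_lift (wqp_basis q) hq).
Proof.
exists h, (pbw_phi (wqp_basis q)), (fun i => lift_cochain (exp_coefz R i)).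
split; [exact: hq| |exact: lift_formal| |exact: wedge_lift_psum].
  split; [exact: Bijective (pbw_phiK _) (pbw_psiK _)|exact: phi_var0|exact: phi_var1|].
  exact: phi_psum_star.
by move=> h' a; exists (lift_cochain (cexpz h') a); exact: psum_lift.
Qed.

Theorem theorem6 (R : realType) (q : R[i]%C) (hq : q != 0) :
  let W := Wqp q in
  let Z := alg_center W in
  let not_root_of_unity := forall N : nat, (0 < N)%N -> q ^+ N != 1 in
  (forall N : nat, N.-primitive_root q ->
     [set c : W | c \in @central _ W] =
       smallest (@subalgebra _ W) [set qp_x q ^+ N; qp_y q ^+ N]) /\
  (not_root_of_unity ->
     [set c : W | c \in @central _ W] = [set c : W | exists a : R[i]%C, c = a%:A]) /\
  exists Dx Dy : derivation W,
    [/\ Dx (qp_x q) = qp_x q, Dx (qp_y q) = 0,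
        Dy (qp_x q) = 0 & Dy (qp_y q) = qp_y q] /\
    (* for q = 1 the algebra is C[x,y] and the rest is false *)
    (q != 1 ->
      let ex := coh_class (der_cocycle Dx) in
      let ey := coh_class (der_cocycle Dy) in
      let exy := coh_class (wedge Dx Dy) in
      (forall h : HH W 1, exists! c : Z * Z, h = c.1 *: ex + c.2 *: ey) /\
      (not_root_of_unity ->
         forall h : HH W 1, exists! c : R[i]%C * R[i]%C,
           h = (c.1%:A : Z) *: ex + (c.2%:A : Z) *: ey) /\
      exists z : cocycle W 2,
        [/\ is_lift (wedge (partial R ord0) (partial R ord_max)) z,
            forall h : HH W 2, exists (a : R[i]%C) (c : Z),
              h = (a%:A : Z) *: coh_class z + c *: exy &
            forall c : Z, c *: exy = 0 -> c = 0]).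
Proof.
move=> W Z nr; have B := wqp_basis q.
split; first by move=> N; exact: center_primitive B N.
split; first exact: center_not_root B.
have [Dx [Dy D]] := euler_derivations B; exists Dx, Dy; split; first exact: D.
move=> q1; case: D => Dxx Dxy Dyx Dyy.
have two_neq0 : (2 : R[i]%C) != 0 by rewrite pnatr_eq0.
split; first exact: (HH1_free B hq q1 Dxx Dxy Dyx Dyy).
split; first by move=> nrq h; exact: (HH1_scalars B hq q1 Dxx Dxy Dyx Dyy h nrq).
(* Any logarithm of q serves as the value of the deformation parameter. *)
have [h hE] := cexp_surj hq.
exists (wedge_lift (wqp_basis q) hE); split.
- exact: wedge_lift_is_lift.
- exact: (HH2_generated (wqp_basis q) hq q1 two_neq0 Dxx Dxy Dyx Dyy hq
    (koszul2_lift _ _ _ two_neq0)).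
- exact: (HH2_torsion_free B hq two_neq0 Dxx Dxy Dyx Dyy).
Qed.
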